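(* Put $g=\gamma_1$, $g_D=\gamma_1^D$ and $B=\mathcal F_{25}\cup\{g,g_D\}$. The implications, relative to $\mathcal V$, between identities in $B$ (including all implications with arbitrarily many premises) are generated by the following rules; that is, for $E\subseteq B$ and $f\in B$, $\mathcal V[E]\models f$ if and only if $f$ belongs to the least subset of $B$ containing $E$ and closed under the rules: Unary rules: $\alpha\Rightarrow\alpha_D,g$; $\ \beta\Rightarrow g,\xi$; $\ \delta\Rightarrow\nu$; $\ \eta_D\Rightarrow\lambda$; $\ g_D\Rightarrow\varepsilon$; $\ \iota_2\Rightarrow\iota_2^D,\mu$; $\ \lambda\Rightarrow\kappa,\mu_2$; $\ \mu_2\Rightarrow\varepsilon$; $\ \nu\Rightarrow\alpha,\iota_2,\nu_D$; $\ \omega\Rightarrow\alpha,\eta,\omega_D$; $\ \rho\Rightarrow\delta,\zeta$; $\ \tau\Rightarrow\chi$; $\ \zeta\Rightarrow\omega,\zeta_D$; $\ \alpha_D\Rightarrow g_D,\kappa$; $\ \chi\Rightarrow\beta,\rho$; $\ \eta\Rightarrow\eta_D$; $\ g\Rightarrow g_D$; $\ \kappa\Rightarrow\varepsilon$; $\ \iota_2^D\Rightarrow\mu_D$; $\ \mu\Rightarrow g,\mu_D$; $\ \mu_D\Rightarrow g_D,\kappa,\mu_2$; $\ \nu_D\Rightarrow\alpha_D,\iota_2^D$; $\ \omega_D\Rightarrow\alpha_D,\eta_D$; $\ s\Rightarrow\beta,\omega$; $\ \xi\Rightarrow\zeta_D$; $\ \zeta_D\Rightarrow\nu_D,\omega_D$.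 Binary rules: $\{\alpha,\mu\}\Rightarrow\iota_2$; $\ \{\alpha_D,\mu_D\}\Rightarrow\iota_2^D$; $\ \{\eta,g\}\Rightarrow\alpha,\iota_2$; $\ \{\eta_D,g_D\}\Rightarrow\alpha_D,\iota_2^D$; $\ \{\beta,\rho\}\Rightarrow\chi$; $\ \{\omega,\xi\}\Rightarrow s$; $\ \{\omega,\nu_D\}\Rightarrow\nu$; $\ \{\omega,\zeta_D\}\Rightarrow\zeta$. Moreover, if $v$ is the right side of any identity in $B$ (in absorption form) and $H\subseteq\mathcal F_{25}$, then the closure $C_{H,p,q}(v)$ depends on $p,q$ ($0\le p\le q\le\infty$) only through whether each of $p$ and $q$ is zero or positive.
   Context: Language: two binary operations $+,\cdot$, no constants. $u\preceq v$ abbreviates $u+v\approx v$. Modulo the commutative ai-semiring axioms (both operations associative and commutative, $x+x\approx x$, distributivity) a term is a finite nonempty set (sum) of commutative monomials. The semiring $R_{12}$: its universe is $\{0,c,p,q,a,b\}$ (letters used as elements only in this paragraph); multiplication is commutative with only nonzero products $pb=bp=ab=ba=aq=qa=c$; addition is the join of the partial order generated by $a<p<0$, $b<q<0$, $c<0$, $a<c$, $b<q<c$. $\mathcal V=\mathsf V(R_{12})$ is the variety generated by $R_{12}$; $\mathcal V[E]$ is the subvariety of $\mathcal V$ defined by adjoining the identities in $E$. In $\mathcal V$ all squares are equal and additively greatest; $0$ denotes this common value. Abbreviations: $C(t,u)=t+tu$, $D(t,u)=t+u+tu$, $L(a,b,c,d)=ab+bc+cd$ (all letters in identities are variables). $\mathcal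 F_{25}$ consists of the 25 identities: $\rho: x\preceq xy$; $\eta: z\preceq x+xy+yz$; $\omega: y\preceq x+xy$; $\zeta: z\preceq C(x,y)+zt$; $\lambda: z\preceq D(x,y)+xz$; $\eta_D: z\preceq x+xy+yz+D(t,u)$; $\omega_D: y\preceq C(x,y)+D(t,u)$; $\zeta_D: z\preceq D(x,y)+zt$; $\mu: ad\preceq b+L(a,b,c,d)$; $\nu: ad\preceq C(t,u)+L(a,b,c,d)$; $\mu_2: ad\preceq b+c+L(a,b,c,d)$; $\mu_D: ad\preceq b+L(a,b,c,d)+D(t,u)$; $\nu_D: ad\preceq L(a,b,c,d)+D(t,u)$; $\delta: ad\preceq L(a,b,c,d)$; $\xi: x^2\approx D(x,y)$; $\beta: xz\preceq C(x,y)+C(t,z)$; $s: x^2\approx C(x,y)$; $\chi: x^2\approx xy$; $\tau: x\approx y$; $\alpha: ad\preceq a+L(a,b,c,d)$; $\alpha_D: ad\preceq a+L(a,b,c,d)+D(t,u)$; $\varepsilon: ad\preceq a+b+c+L(a,b,c,d)$; $\kappa: ad\preceq a+b+L(a,b,c,d)$; $\iota_2: x_0x_5\preceq x_1+\sum_{j=0}^4x_jx_{j+1}$; $\iota_2^D: x_0x_5\preceq x_1+\sum_{j=0}^4x_jx_{j+1}+D(t,u)$. Each $f$ is read as an absorption $q_f\preceq v_f$ with right side $v_f$: the square identities $\xi,s,\chi$ are read as $0\preceq v_f$ with $v_f=D(x,y),C(x,y),xy$, and $\tau$ as $y\preceq x$. $\gamma_1:\ x_0y\preceq x_0+x_2+x_0x_1+x_1x_2+x_2y$;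 $\ \gamma_1^D:\ x_0y\preceq x_0+x_2+x_0x_1+x_1x_2+x_2y+D(t,u)$. Closure. For a term $v$: $M(v)$ is the set of variables occurring as linear summands; $G(v)$ has as edges the square-free quadratic summands, and as vertices only the variables incident with an edge; $W(v)=M(v)\cap V(G(v))$ is the set of marked vertices. A term is basic-zero if it contains a square, a monomial of degree at least three, or if $G(v)$ has an odd cycle; otherwise $G(v)$ is bipartite. A component is a D-component if both of its bipartition classes contain marked vertices. Environment rule: a basic-zero term becomes $0$; otherwise add all edges between marked vertices in opposite classes of the same component. If $\tau\in H$, all terms have the same normal form. If $\tau\notin H$, $C_{H,p,q}(v)$ is the least extension of the environment normal form of $v$ closed under: (1) for each $f\in H$ and each map of the variables of $v_f$ into the variables of the term (identifications allowed), include the image of $q_f$ whenever all image summands of $v_f$ are present; a square query is interpreted as $0$ and sends the result to $0$; (2) with $k=p$ if the current term has no D-component and $k=q$ otherwise, for any two marked vertices $x,x'$ in the same component and class at distance at most $2k$, join $x$ to every neighbour of $x'$ (for $k=\infty$ only the same component and class are required); (3) the environment rule. *)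

(* Defs.v *)
From HB Require Import structures.
From Stdlib Require Import Relation_Operators.
From mathcomp Require Import all_boot finmap multiset.

Set Implicit Arguments.
Unset Strict Implicit.
Unset Printing Implicit Defensive.

(* The carrier may be empty: the empty algebra satisfies every identity, so
   admitting it does not affect which identities follow from which. *)
Record algebra := Algebra {
  carrier :> Type;
  addA : carrier -> carrier -> carrier;
  mulA : carrier -> carrier -> carrier
}.

Inductive term :=
  | Var of nat
  | Add of term & term
  | Mul of term & term.

Declare Scope term_scope.
Delimit Scope term_scope with term.
Bind Scope term_scope with term.
Notation "s + t" := (Add s t) : term_scope.
Notation "s * t" := (Mul s t) : term_scope.

Fixpoint eval (A : algebra) (h : nat -> A) (t : term) : A :=
  match t with
  | Var i => h i
  | Add s t => addA (eval h s) (eval h t)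
  | Mul s t => mulA (eval h s) (eval h t)
  end.

Definition identity := (term * term)%type.

Definition satisfies (A : algebra) (e : identity) :=
  forall h : nat -> A, eval h e.1 = eval h e.2.

(* [u ⪯ v] *)
Definition absorbs (u v : term) : identity := ((u + v)%term, v).

Definition is_hom (A B : algebra) (f : A -> B) :=
  (forall x y, f (addA x y) = addA (f x) (f y)) /\
  (forall x y, f (mulA x y) = mulA (f x) (f y)).

Definition prod_algebra (I : Type) (A : I -> algebra) : algebra :=
  @Algebra (forall i, A i)
    (fun x y i => addA (x i) (y i)) (fun x y i => mulA (x i) (y i)).

Definition variety (K : algebra -> Prop) :=
  [/\ forall (A B : algebra) (f : A -> B),
        is_hom f -> (forall y, exists x, f x = y) -> K A -> K B,
      forall (A B : algebra) (f : B -> A),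
        is_hom f -> injective f -> K A -> K B
    & forall (I : Type) (A : I -> algebra),
        (forall i, K (A i)) -> K (prod_algebra A)].

Definition generated_variety (A B : algebra) :=
  forall K, variety K -> K A -> K B.

Inductive R12_elt := R0 | Rc | Rp | Rq | Ra | Rb.

Definition R12_mul x y :=
  match x, y with
  | Rp, Rb | Rb, Rp | Ra, Rb | Rb, Ra | Ra, Rq | Rq, Ra => Rc
  | _, _ => R0
  end.

Inductive R12_lt : R12_elt -> R12_elt -> Prop :=
  | lt_ap : R12_lt Ra Rp
  | lt_p0 : R12_lt Rp R0
  | lt_bq : R12_lt Rb Rq
  | lt_q0 : R12_lt Rq R0
  | lt_c0 : R12_lt Rc R0
  | lt_ac : R12_lt Ra Rc
  | lt_qc : R12_lt Rq Rc.

Definition R12_le := clos_refl_trans R12_elt R12_lt.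

(* The join of [R12_le]; see [R12_addP]. *)
Definition R12_add x y :=
  match x, y with
  | Rc, (Rc | Rq | Ra | Rb) | (Rq | Ra | Rb), Rc => Rc
  | Rp, (Rp | Ra) | Ra, Rp => Rp
  | Rq, (Rq | Rb) | Rb, Rq => Rq
  | Ra, (Rq | Rb) | (Rq | Rb), Ra => Rc
  | Ra, Ra => Ra
  | Rb, Rb => Rb
  | _, _ => R0
  end.

Definition R12_leb x y :=
  match x, y with
  | _, R0 | Rc, Rc | Rp, Rp | Rq, Rq | Ra, Ra | Rb, Rb => true
  | Ra, Rp | Ra, Rc | Rb, Rq | Rb, Rc | Rq, Rc => true
  | _, _ => false
  end.

Lemma R12_leP x y : R12_le x y <-> R12_leb x y.
Proof.
split; first by elim=> [? ? []|[]|[] [] [] _ h1 _ h2].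
have ac : R12_le Ra Rc by apply: rt_step; constructor.
have qc : R12_le Rq Rc by apply: rt_step; constructor.
have bq : R12_le Rb Rq by apply: rt_step; constructor.
have c0 : R12_le Rc R0 by apply: rt_step; constructor.
by case: x y => [] [] // _;
  try (by apply: rt_refl); try (by apply: rt_step; constructor);
  do ?[exact: rt_trans qc | exact: rt_trans ac c0 | exact: rt_trans bq qc
      | exact: rt_trans bq (rt_trans _ _ _ _ _ qc c0)].
Qed.

Lemma R12_le_anti x y : R12_le x y -> R12_le y x -> x = y.
Proof. by rewrite !R12_leP; case: x y => [] []. Qed.

Lemma R12_addP x y z : R12_le (R12_add x y) z <-> R12_le x z /\ R12_le y z.
Proof. by rewrite !R12_leP; case: x y z => [] [] [] /=; split=> // -[]. Qed.

Definition R12 : algebra := @Algebra R12_elt R12_add R12_mul.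

Definition V12 : algebra -> Prop := generated_variety R12.

Inductive ident :=
  | i_rho | i_eta | i_omega | i_zeta | i_lambda | i_eta_D | i_omega_D
  | i_zeta_D | i_mu | i_nu | i_mu_2 | i_mu_D | i_nu_D | i_delta | i_xi
  | i_beta | i_s | i_chi | i_tau | i_alpha | i_alpha_D | i_epsilon | i_kappa
  | i_iota_2 | i_iota_2_D | i_gamma_1 | i_gamma_1_D.

Definition all_ident : seq ident :=
  [:: i_rho; i_eta; i_omega; i_zeta; i_lambda; i_eta_D; i_omega_D;
      i_zeta_D; i_mu; i_nu; i_mu_2; i_mu_D; i_nu_D; i_delta; i_xi;
      i_beta; i_s; i_chi; i_tau; i_alpha; i_alpha_D; i_epsilon; i_kappa;
      i_iota_2; i_iota_2_D; i_gamma_1; i_gamma_1_D].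

Definition ident_code (f : ident) : nat :=
  match f with
  | i_rho => 0 | i_eta => 1 | i_omega => 2 | i_zeta => 3 | i_lambda => 4
  | i_eta_D => 5 | i_omega_D => 6 | i_zeta_D => 7 | i_mu => 8 | i_nu => 9
  | i_mu_2 => 10 | i_mu_D => 11 | i_nu_D => 12 | i_delta => 13 | i_xi => 14
  | i_beta => 15 | i_s => 16 | i_chi => 17 | i_tau => 18 | i_alpha => 19
  | i_alpha_D => 20 | i_epsilon => 21 | i_kappa => 22 | i_iota_2 => 23
  | i_iota_2_D => 24 | i_gamma_1 => 25 | i_gamma_1_D => 26
  end.

Lemma ident_codeK : cancel ident_code (nth i_rho all_ident).
Proof. by case. Qed.

HB.instance Definition _ := Countable.copy ident (can_type ident_codeK).

Lemma all_identP : Finite.axiom all_ident.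
Proof. by case. Qed.

HB.instance Definition _ := isFinite.Build ident all_identP.

Definition F25 : {set ident} := ~: [set i_gamma_1; i_gamma_1_D].

Section Identities.

Local Open Scope term_scope.

Let x := Var 0.
Let y := Var 1.
Let z := Var 2.
Let t := Var 3.
Let u := Var 4.
Let a := Var 5.
Let b := Var 6.
Let c := Var 7.
Let d := Var 8.
Let x0 := Var 9.
Let x1 := Var 10.
Let x2 := Var 11.
Let x3 := Var 12.
Let x4 := Var 13.
Let x5 := Var 14.

Let C (t u : term) := t + t * u.
Let D (t u : term) := t + u + t * u.
Let L (a b c d : term) := a * b + b * c + c * d.

Let path5 := x0 * x1 + x1 * x2 + x2 * x3 + x3 * x4 + x4 * x5.
Let path3 := x0 * x1 + x1 * x2 + x2 * y.

(* The absorption form [q ⪯ v] as the pair [(q, v)]. All squares are equal to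
   the additively greatest element 0 throughout the variety, and the query 0
   of xi, s and chi is represented by the square [x * x]. *)
Definition absorption (f : ident) : term * term :=
  match f with
  | i_rho       => (x, x * y)
  | i_eta       => (z, x + x * y + y * z)
  | i_omega     => (y, x + x * y)
  | i_zeta      => (z, C x y + z * t)
  | i_lambda    => (z, D x y + x * z)
  | i_eta_D     => (z, x + x * y + y * z + D t u)
  | i_omega_D   => (y, C x y + D t u)
  | i_zeta_D    => (z, D x y + z * t)
  | i_mu        => (a * d, b + L a b c d)
  | i_nu        => (a * d, C t u + L a b c d)
  | i_mu_2      => (a * d, b + c + L a b c d)
  | i_mu_D      => (a * d, b + L a b c d + D t u)
  | i_nu_D      => (a * d, L a b c d + D t u)
  | i_delta     => (a * d, L a b c d)
  | i_xi        => (x * x, D x y)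
  | i_beta      => (x * z, C x y + C t z)
  | i_s         => (x * x, C x y)
  | i_chi       => (x * x, x * y)
  | i_tau       => (y, x)
  | i_alpha     => (a * d, a + L a b c d)
  | i_alpha_D   => (a * d, a + L a b c d + D t u)
  | i_epsilon   => (a * d, a + b + c + L a b c d)
  | i_kappa     => (a * d, a + b + L a b c d)
  | i_iota_2    => (x0 * x5, x1 + path5)
  | i_iota_2_D  => (x0 * x5, x1 + path5 + D t u)
  | i_gamma_1   => (x0 * y, x0 + x2 + path3)
  | i_gamma_1_D => (x0 * y, x0 + x2 + path3 + D t u)
  end.

Definition query (f : ident) : term := (absorption f).1.
Definition rhs (f : ident) : term := (absorption f).2.

Definition ident_eq (f : ident) : identity :=
  match f with
  | i_xi  => (x * x, D x y)
  | i_s   => (x * x, C x y)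
  | i_chi => (x * x, x * y)
  | i_tau => (x, y)
  | _     => absorbs (query f) (rhs f)
  end.

End Identities.

(* V[E] |= f *)
Definition entails (E : {set ident}) (f : ident) :=
  forall A : algebra, V12 A ->
    (forall e, e \in E -> satisfies A (ident_eq e)) -> satisfies A (ident_eq f).

Definition rules : seq (seq ident * seq ident) :=
  [:: ([:: i_alpha],    [:: i_alpha_D; i_gamma_1]);
      ([:: i_beta],     [:: i_gamma_1; i_xi]);
      ([:: i_delta],    [:: i_nu]);
      ([:: i_eta_D],    [:: i_lambda]);
      ([:: i_gamma_1_D], [:: i_epsilon]);
      ([:: i_iota_2],   [:: i_iota_2_D; i_mu]);
      ([:: i_lambda],   [:: i_kappa; i_mu_2]);
      ([:: i_mu_2],     [:: i_epsilon]);
      ([:: i_nu],       [:: i_alpha; i_iota_2; i_nu_D]);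
      ([:: i_omega],    [:: i_alpha; i_eta; i_omega_D]);
      ([:: i_rho],      [:: i_delta; i_zeta]);
      ([:: i_tau],      [:: i_chi]);
      ([:: i_zeta],     [:: i_omega; i_zeta_D]);
      ([:: i_alpha_D],  [:: i_gamma_1_D; i_kappa]);
      ([:: i_chi],      [:: i_beta; i_rho]);
      ([:: i_eta],      [:: i_eta_D]);
      ([:: i_gamma_1],  [:: i_gamma_1_D]);
      ([:: i_kappa],    [:: i_epsilon]);
      ([:: i_iota_2_D], [:: i_mu_D]);
      ([:: i_mu],       [:: i_gamma_1; i_mu_D]);
      ([:: i_mu_D],     [:: i_gamma_1_D; i_kappa; i_mu_2]);
      ([:: i_nu_D],     [:: i_alpha_D; i_iota_2_D]);
      ([:: i_omega_D],  [:: i_alpha_D; i_eta_D]);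
      ([:: i_s],        [:: i_beta; i_omega]);
      ([:: i_xi],       [:: i_zeta_D]);
      ([:: i_zeta_D],   [:: i_nu_D; i_omega_D]);

      ([:: i_alpha; i_mu],          [:: i_iota_2]);
      ([:: i_alpha_D; i_mu_D],      [:: i_iota_2_D]);
      ([:: i_eta; i_gamma_1],       [:: i_alpha; i_iota_2]);
      ([:: i_eta_D; i_gamma_1_D],   [:: i_alpha_D; i_iota_2_D]);
      ([:: i_beta; i_rho],          [:: i_chi]);
      ([:: i_omega; i_xi],          [:: i_s]);
      ([:: i_omega; i_nu_D],        [:: i_nu]);
      ([:: i_omega; i_zeta_D],      [:: i_zeta])].

Definition rule_closed (F : {set ident}) : bool :=
  all (fun r => all (fun e => e \in F) r.1 ==> all (fun e => e \in F) r.2)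
    rules.

Definition rule_closure (E : {set ident}) : {set ident} :=
  \bigcap_(F : {set ident} | (E \subset F) && rule_closed F) F.

Local Open Scope mset_scope.

Definition polynomial := {fset {mset nat}}%fset.

Fixpoint summands (t : term) : polynomial :=
  match t with
  | Var i => [fset [mset i]]%fset
  | Add s t => (summands s `|` summands t)%fset
  | Mul s t => [fset m `+` n | m in summands s, n in summands t]%fset
  end.

Fixpoint rename (phi : nat -> nat) (t : term) : term :=
  match t with
  | Var i => Var (phi i)
  | Add s t => Add (rename phi s) (rename phi t)
  | Mul s t => Mul (rename phi s) (rename phi t)
  end.

Section Graph.

Variable v : polynomial.

Definition edge : rel nat :=
  fun x y => (x != y) && ([mset x; y] \in v).

Definition marked (x : nat) :=
  [mset x] \in v /\ exists y, edge x y.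

Definition walk (n x y : nat) :=
  exists p : seq nat, [/\ path edge x p, last x p = y & size p = n].

Definition same_component (x y : nat) := exists n, walk n x y.

(* In a bipartite graph the bipartition class of a vertex of a component is
   the parity of the walks reaching it from a fixed vertex. *)
Definition same_class (x y : nat) := exists n, ~~ odd n /\ walk n x y.
Definition opposite_class (x y : nat) := exists n, odd n /\ walk n x y.

Definition distance_le (n x y : nat) := exists2 m, m <= n & walk m x y.

Definition odd_cycle := exists c : seq nat, ucycle edge c /\ odd (size c).

Definition basic_zero :=
  [\/ exists x, [mset x; x] \in v,
      exists2 m : {mset nat}, m \in v & 3 <= size m
    | odd_cycle].

Definition has_D_component :=
  exists x y, [/\ marked x, marked y & opposite_class x y].

End Graph.

Inductive nform := Zero | Sum of polynomial.

Definition nform_le (N N' : nform) : Prop :=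
  match N, N' with
  | _, Zero => True
  | Zero, Sum _ => False
  | Sum v, Sum w => (v `<=` w)%fset
  end.

(* [env_rule N N']: the environment rule turns [N] into [N']. *)
Inductive env_rule : nform -> nform -> Prop :=
  | env_Zero : env_rule Zero Zero
  | env_basic_zero v : basic_zero v -> env_rule (Sum v) Zero
  | env_edges v w : ~ basic_zero v ->
      (forall m, m \in w <-> m \in v \/
         exists x y, [/\ m = [mset x; y], marked v x, marked v y
                       & opposite_class v x y]) ->
      env_rule (Sum v) (Sum w).

(* [None] is infinity. *)
Definition enat := option nat.

Definition enat_le (p q : enat) : bool :=
  match p, q with
  | _, None => true
  | None, Some _ => false
  | Some m, Some n => m <= n
  end.

(* Only the images of the summands of the right side matter, and their
   presence already forces [phi] to take the variables of the right side to
   variables of [v]. When the image of the query is a square, its inclusion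
   makes [v] basic-zero, so that together with the environment rule only
   [Zero] remains. *)
Definition rule1_closed (H : {set ident}) (v : polynomial) :=
  forall f (phi : nat -> nat), f \in H ->
    (summands (rename phi (rhs f)) `<=` v)%fset ->
    (summands (rename phi (query f)) `<=` v)%fset.

Definition within (k : enat) (v : polynomial) (x x' : nat) :=
  if k is Some n then distance_le v n.*2 x x' else True.

Definition join_closed (k : enat) (v : polynomial) :=
  forall x x' y, marked v x -> marked v x' -> same_class v x x' ->
    within k v x x' -> edge v x' y -> edge v x y.

Definition rule2_closed (p q : enat) (v : polynomial) :=
  (~ has_D_component v -> join_closed p v) /\
  (has_D_component v -> join_closed q v).

Definition closed (H : {set ident}) (p q : enat) (N : nform) :=
  env_rule N N /\
  if N is Sum v then rule1_closed H v /\ rule2_closed p q v else True.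

(* [is_closure H p q v N]: [N] is C_{H,p,q}(v). If tau is in [H], the normal
   form common to all terms is taken to be [Zero]. *)
Definition is_closure (H : {set ident}) (p q : enat) (v : term) (N : nform) :=
  if i_tau \in H then N = Zero else
  exists N0, [/\ env_rule (Sum (summands v)) N0,
    nform_le N0 N,
    closed H p q N
  & forall N', nform_le N0 N' -> closed H p q N' -> nform_le N N'].

(* Main.v *)
(* Over V, an absorption q <= v says the following about every element T of an
   algebra: if the summands of v lie below T, so does q. Hence each identity of B
   other than tau is a Horn clause on the marked graph whose marked vertices are
   the x <= T and whose edges are the pairs with xy <= T, and the rules are
   derivations between Horn clauses, using only that squares are greatest and
   that ad <= a + d + ab + bc + cd.

   Conversely, a finite family of assignments of the vertices in R12 defines the
   marked graph of what all of them send below c. Keeping linear elements and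
   collapsing the others by the ideal of c gives an algebra of V that satisfies
   exactly the clauses holding in this graph; 24 such graphs separate every rule
   closed set from every identity outside it.

   For the last assertion, the closure is the least closed term. If k is positive
   and the join rule for distance at most 2k does not give the one for all
   distances, then two marked vertices of the same class have no common neighbour,
   hence lie on a path with at least five vertices. Their component has no marked
   vertex in the opposite class, so it is not that of a summand D(t,u), and counting
   vertices leaves only nu, iota_2 and iota_2^D. There
   either H creates further marks which supply the common neighbour, or the closure
   stays inside a term with too few marked vertices. *)

Require Import Defs.
From mathcomp Require Import all_boot finmap multiset boolp.

Set Implicit Arguments.
Unset Strict Implicit.
Unset Printing Implicit Defensive.

(** * Horn clauses *)

Section Horn.

Variables (T : Type) (m : T -> Prop) (e : T -> T -> Prop).

(** The terms in [absorption] are sums of variables and of products of two variables ([quadratic]),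
    so every other product may go to [False]. *)
Fixpoint holds (phi : nat -> T) (s : term) : Prop :=
  match s with
  | Var i => m (phi i)
  | Add s1 s2 => holds phi s1 /\ holds phi s2
  | Mul (Var i) (Var j) => e (phi i) (phi j)
  | Mul _ _ => False
  end.

Definition horn (f : ident) : Prop :=
  forall phi, holds phi (rhs f) -> holds phi (query f).

(* Valuations of the variables, which [absorption] numbers as x, y, z, t, u = 0..4,
   a, b, c, d = 5..8 and x0, ..., x5 = 9..14. *)
Definition xyztu (x y z t u : T) : nat -> T := nth x [:: x; y; z; t; u].

Definition abcdtu (a b c d t u : T) : nat -> T :=
  nth a [:: a; a; a; t; u; a; b; c; d].

Definition pathytu (x0 x1 x2 x3 x4 x5 y t u : T) : nat -> T :=
  nth x0 [:: x0; y; x0; t; u; x0; x0; x0; x0; x0; x1; x2; x3; x4; x5].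

Hypothesis e_sym : forall x y, e x y -> e y x.
Hypothesis e_square : forall x, e x x -> (forall y, m y) /\ forall y z, e y z.
Hypothesis e_path3 :
  forall a b c d, m a -> m d -> e a b -> e b c -> e c d -> e a d.
(** The clause of [i_tau] speaks of marks only; this is how it reaches edges and yields [i_chi].
    Below an element [T] it holds because [T] itself is marked. *)
Hypothesis m_trivial : (forall x y, m x -> m y) -> forall x y, e x y.

Let weaken f g : rhs g = rhs g -> query f = query g ->
  (forall phi, holds phi (rhs g) -> holds phi (rhs f)) -> horn f -> horn g.
Proof. by move=> _ q w hf phi /w/hf; rewrite q. Qed.

Ltac premises :=
  intro phi; simpl; intros;
  repeat match goal with H : _ /\ _ |- _ => destruct H end.
Ltac by_horn H phi := apply: (H phi); rewrite /=; repeat split; auto.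
Ltac by_weaken H := move: H; apply: weaken => // phi /=; tauto.

(** Stated for an abstract marked graph because it is applied both to the graph below an element of
    an algebra and to the block graphs that bound closures. *)
Lemma horn_rules (r : seq ident * seq ident) :
  r \in rules -> (forall g, g \in r.1 -> horn g) ->
  forall g, g \in r.2 -> horn g.
Proof.
move=> rR P.
have {}P : foldr (fun g => and (horn g)) True r.1.
  elim: r.1 P => //= g s IH P; split; first by apply: P; rewrite inE eqxx.
  by apply: IH => h hs; apply: P; rewrite inE hs orbT.
suff Q : foldr (fun g => and (horn g)) True r.2.
  move=> g; elim: r.2 Q => //= h s IH [Ph Ps].
  by rewrite inE => /orP[/eqP-> //|/IH]; apply.
move: rR P; rewrite /rules.
repeat (rewrite inE => /orP[/eqP-> {r} /=|]); try (rewrite inE => /eqP-> {r} /=).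
- case=> H _; split; last split=> //; first by by_weaken H.
  by premises; by_horn H (abcdtu (phi 9) (phi 10) (phi 11) (phi 1) (phi 3) (phi 4)).
- case=> H _; split; last split=> //; premises.
    by by_horn H (xyztu (phi 9) (phi 10) (phi 1) (phi 11) (phi 11)).
  by by_horn H (xyztu (phi 0) (phi 1) (phi 0) (phi 1) (phi 1)).
- by case=> H _; split=> //; by_weaken H.
- case=> H _; split=> //; premises.
  by by_horn H (xyztu (phi 1) (phi 0) (phi 2) (phi 0) (phi 1)).
- case=> H _; split=> //; premises.
  by by_horn H (pathytu (phi 5) (phi 6) (phi 7) (phi 7) (phi 7) (phi 7) (phi 8)
    (phi 5) (phi 6)).
- case=> H _; split; last split=> //; first by by_weaken H.
  premises; by_horn H (pathytu (phi 5) (phi 6) (phi 7) (phi 6) (phi 7) (phi 8)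
    (phi 5) (phi 5) (phi 5)).
- case=> H _; split; last split=> //; premises.
    have c : m (phi 7) by by_horn H (xyztu (phi 6) (phi 5) (phi 7) (phi 5) (phi 5)).
    have d : m (phi 8) by by_horn H (xyztu (phi 7) (phi 6) (phi 8) (phi 5) (phi 5)).
    by apply: (@e_path3 _ (phi 6) (phi 7)).
  have a : m (phi 5) by by_horn H (xyztu (phi 6) (phi 7) (phi 5) (phi 5) (phi 5)).
  have d : m (phi 8) by by_horn H (xyztu (phi 7) (phi 6) (phi 8) (phi 5) (phi 5)).
  by apply: (@e_path3 _ (phi 6) (phi 7)).
- by case=> H _; split=> //; by_weaken H.
- case=> H _; split; last split; last split=> //; premises.
  + by by_horn H (abcdtu (phi 5) (phi 6) (phi 7) (phi 8) (phi 5) (phi 6)).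
  (* The path is contracted twice, first [x0 x1 x2 x3], then [x0 x3 x4 x5]; the mark [x1] and the
     edge [x1 x2] serve as [C t u] both times. *)
  + have h : e (phi 9) (phi 12).
      by by_horn H (abcdtu (phi 9) (phi 10) (phi 11) (phi 12) (phi 10) (phi 11)).
    by by_horn H (abcdtu (phi 9) (phi 12) (phi 13) (phi 14) (phi 10) (phi 11)).
  + by by_horn H (abcdtu (phi 5) (phi 6) (phi 7) (phi 8) (phi 3) (phi 4)).
- case=> H _; split; last split; last split=> //; premises.
  + have b : m (phi 6) by by_horn H (xyztu (phi 5) (phi 6) (phi 5) (phi 5) (phi 5)).
    have c : m (phi 7) by by_horn H (xyztu (phi 6) (phi 7) (phi 5) (phi 5) (phi 5)).
    have d : m (phi 8) by by_horn H (xyztu (phi 7) (phi 8) (phi 5) (phi 5) (phi 5)).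
    by apply: (@e_path3 _ (phi 6) (phi 7)).
  + have y : m (phi 1) by by_horn H (xyztu (phi 0) (phi 1) (phi 0) (phi 0) (phi 0)).
    by by_horn H (xyztu (phi 1) (phi 2) (phi 0) (phi 0) (phi 0)).
  + by by_horn H (xyztu (phi 0) (phi 1) (phi 0) (phi 0) (phi 0)).
- case=> H _; split; last split=> //; premises.
    have a : m (phi 5) by by_horn H (xyztu (phi 5) (phi 6) (phi 5) (phi 5) (phi 5)).
    have d : m (phi 8) by by_horn H (xyztu (phi 8) (phi 7) (phi 5) (phi 5) (phi 5)).
    by apply: (@e_path3 _ (phi 6) (phi 7)).
  by by_horn H (xyztu (phi 2) (phi 3) (phi 5) (phi 5) (phi 5)).
- case=> H _; split=> // phi _; apply: m_trivial => x y.
  exact: (H (xyztu x y x x x)).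
- case=> H _; split; last split=> //; first premises; last by by_weaken H.
  by by_horn H (xyztu (phi 0) (phi 1) (phi 1) (phi 0) (phi 0)).
- case=> H _; split; last split=> //; premises.
    by by_horn H (abcdtu (phi 9) (phi 10) (phi 11) (phi 1) (phi 3) (phi 4)).
  by by_horn H (abcdtu (phi 5) (phi 6) (phi 7) (phi 8) (phi 5) (phi 6)).
- case=> H _; split; last split=> //; premises.
    have [_ Z] : (forall y, m y) /\ forall y z, e y z.
      apply: (@e_square (phi 0)).
      by by_horn H (xyztu (phi 0) (phi 1) (phi 0) (phi 0) (phi 0)).
    exact: Z.
  have [Z _] : (forall y, m y) /\ forall y z, e y z.
    apply: (@e_square (phi 0)).
    by by_horn H (xyztu (phi 0) (phi 1) (phi 0) (phi 0) (phi 0)).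
  exact: Z.
- by case=> H _; split=> //; by_weaken H.
- by case=> H _; split=> //; by_weaken H.
- by case=> H _; split=> //; by_weaken H.
- case=> H _; split=> //; premises.
  by by_horn H (pathytu (phi 5) (phi 6) (phi 7) (phi 6) (phi 7) (phi 8)
    (phi 5) (phi 3) (phi 4)).
- case=> H _; split; last split=> //; last by by_weaken H.
  premises; apply: e_sym.
  by by_horn H (abcdtu (phi 1) (phi 11) (phi 10) (phi 9) (phi 1) (phi 1)).
- case=> H _; split; last split; last split=> //; premises.
  + apply: e_sym.
    by by_horn H (abcdtu (phi 1) (phi 11) (phi 10) (phi 9) (phi 3) (phi 4)).
  + by by_horn H (abcdtu (phi 5) (phi 6) (phi 7) (phi 8) (phi 5) (phi 6)).
  + by by_horn H (abcdtu (phi 5) (phi 6) (phi 7) (phi 8) (phi 6) (phi 7)).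
- case=> H _; split; last split=> //; first by by_weaken H.
  premises.
  have h : e (phi 9) (phi 12).
    by by_horn H (abcdtu (phi 9) (phi 10) (phi 11) (phi 12) (phi 3) (phi 4)).
  by by_horn H (abcdtu (phi 9) (phi 12) (phi 13) (phi 14) (phi 3) (phi 4)).
- case=> H _; split; last split=> //; premises.
    have b : m (phi 6) by by_horn H (xyztu (phi 5) (phi 6) (phi 5) (phi 3) (phi 4)).
    have c : m (phi 7) by by_horn H (xyztu (phi 6) (phi 7) (phi 5) (phi 3) (phi 4)).
    have d : m (phi 8) by by_horn H (xyztu (phi 7) (phi 8) (phi 5) (phi 3) (phi 4)).
    by apply: (@e_path3 _ (phi 6) (phi 7)).
  have y : m (phi 1) by by_horn H (xyztu (phi 0) (phi 1) (phi 0) (phi 3) (phi 4)).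
  by by_horn H (xyztu (phi 1) (phi 2) (phi 0) (phi 3) (phi 4)).
- case=> H _; split; last split=> //; premises.
    have [_ Z] : (forall y, m y) /\ forall y z, e y z.
      apply: (@e_square (phi 0)).
      by by_horn H (xyztu (phi 0) (phi 1) (phi 0) (phi 0) (phi 0)).
    exact: Z.
  have [Z _] : (forall y, m y) /\ forall y z, e y z.
    apply: (@e_square (phi 0)).
    by by_horn H (xyztu (phi 0) (phi 1) (phi 0) (phi 0) (phi 0)).
  exact: Z.
- case=> H _; split=> //; premises.
  have [Z _] : (forall y, m y) /\ forall y z, e y z.
    apply: (@e_square (phi 0)).
    by by_horn H (xyztu (phi 0) (phi 1) (phi 0) (phi 0) (phi 0)).
  exact: Z.
- case=> H _; split; last split=> //; premises.
    have a : m (phi 5) by by_horn H (xyztu (phi 3) (phi 4) (phi 5) (phi 6) (phi 5)).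
    have d : m (phi 8) by by_horn H (xyztu (phi 3) (phi 4) (phi 8) (phi 7) (phi 5)).
    by apply: (@e_path3 _ (phi 6) (phi 7)).
  by by_horn H (xyztu (phi 3) (phi 4) (phi 1) (phi 0) (phi 0)).
- case=> A [M _]; split=> //; premises.
  have h03 : e (phi 9) (phi 12).
    by by_horn M (abcdtu (phi 9) (phi 10) (phi 11) (phi 12) (phi 3) (phi 4)).
  (* [i_alpha] starts at the marked [x1] and gives the edge [x1 x4]; on the path [x0 x1 x4 x5] the
     second vertex is marked, as [i_mu] requires. *)
  have h14 : e (phi 10) (phi 13).
    by by_horn A (abcdtu (phi 10) (phi 11) (phi 12) (phi 13) (phi 3) (phi 4)).
  by by_horn M (abcdtu (phi 9) (phi 10) (phi 13) (phi 14) (phi 3) (phi 4)).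
- case=> A [M _]; split=> //; premises.
  have h14 : e (phi 10) (phi 13).
    by by_horn A (abcdtu (phi 10) (phi 11) (phi 12) (phi 13) (phi 3) (phi 4)).
  by by_horn M (abcdtu (phi 9) (phi 10) (phi 13) (phi 14) (phi 3) (phi 4)).
- case=> N [G _]; split; last split=> //; premises.
    have c : m (phi 7) by by_horn N (xyztu (phi 5) (phi 6) (phi 7) (phi 5) (phi 5)).
    by by_horn G (pathytu (phi 5) (phi 6) (phi 7) (phi 5) (phi 5) (phi 5) (phi 8)
      (phi 5) (phi 5)).
  (* [i_eta] carries the mark of [x1] to [x3] and [x5]. Then [i_gamma_1] is used from the far end,
     on [x5 x4 x3 x2] and on [x5 x2 x1 x0]. *)
  have x3 : m (phi 12) by
    by_horn N (xyztu (phi 10) (phi 11) (phi 12) (phi 10) (phi 10)).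
  have x5 : m (phi 14) by
    by_horn N (xyztu (phi 12) (phi 13) (phi 14) (phi 10) (phi 10)).
  have h52 : e (phi 14) (phi 11).
    by by_horn G (pathytu (phi 14) (phi 13) (phi 12) (phi 9) (phi 9) (phi 9) (phi 11)
      (phi 9) (phi 9)).
  apply: e_sym.
  by by_horn G (pathytu (phi 14) (phi 11) (phi 10) (phi 9) (phi 9) (phi 9) (phi 9)
    (phi 9) (phi 9)).
- case=> N [G _]; split; last split=> //; premises.
    have c : m (phi 7) by by_horn N (xyztu (phi 5) (phi 6) (phi 7) (phi 3) (phi 4)).
    by by_horn G (pathytu (phi 5) (phi 6) (phi 7) (phi 5) (phi 5) (phi 5) (phi 8)
      (phi 3) (phi 4)).
  have x3 : m (phi 12) by
    by_horn N (xyztu (phi 10) (phi 11) (phi 12) (phi 3) (phi 4)).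
  have x5 : m (phi 14) by
    by_horn N (xyztu (phi 12) (phi 13) (phi 14) (phi 3) (phi 4)).
  have h52 : e (phi 14) (phi 11).
    by by_horn G (pathytu (phi 14) (phi 13) (phi 12) (phi 9) (phi 9) (phi 9) (phi 11)
      (phi 3) (phi 4)).
  apply: e_sym.
  by by_horn G (pathytu (phi 14) (phi 11) (phi 10) (phi 9) (phi 9) (phi 9) (phi 9)
    (phi 3) (phi 4)).
- case=> B [R _]; split=> //; premises.
  have x : m (phi 0) by by_horn R (xyztu (phi 0) (phi 1) (phi 0) (phi 0) (phi 0)).
  have y : m (phi 1) by by_horn R (xyztu (phi 1) (phi 0) (phi 0) (phi 0) (phi 0)).
  by by_horn B (xyztu (phi 0) (phi 1) (phi 0) (phi 1) (phi 1)).
- case=> O [X _]; split=> //; premises.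
  have y : m (phi 1) by by_horn O (xyztu (phi 0) (phi 1) (phi 0) (phi 0) (phi 0)).
  by by_horn X (xyztu (phi 0) (phi 1) (phi 0) (phi 1) (phi 1)).
- case=> O [N _]; split=> //; premises.
  have u : m (phi 4) by by_horn O (xyztu (phi 3) (phi 4) (phi 0) (phi 0) (phi 0)).
  by by_horn N (abcdtu (phi 5) (phi 6) (phi 7) (phi 8) (phi 3) (phi 4)).
- case=> O [Z _]; split=> //; premises.
  have y : m (phi 1) by by_horn O (xyztu (phi 0) (phi 1) (phi 0) (phi 0) (phi 0)).
  by by_horn Z (xyztu (phi 0) (phi 1) (phi 2) (phi 3) (phi 0)).
Qed.

End Horn.

Lemma sub_holds (T : Type) (m m' : T -> Prop) (e e' : T -> T -> Prop) phi s :
  (forall x, m x -> m' x) -> (forall x y, e x y -> e' x y) ->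
  holds m e phi s -> holds m' e' phi s.
Proof.
move=> mm' ee'; elim: s => [i|s1 IH1 s2 IH2 [/IH1 ? /IH2 ?] //|s1 _ s2 _] /=.
  exact: mm'.
by case: s1 => // i; case: s2 => // j; apply: ee'.
Qed.

(** * Soundness of the rules *)

Lemma eval_hom (A B : algebra) (f : A -> B) (h : nat -> A) s :
  is_hom f -> f (eval h s) = eval (f \o h) s.
Proof. by move=> [fD fM]; elim: s => //= s1 IH1 s2 IH2; rewrite ?fD ?fM IH1 IH2. Qed.

Lemma eval_prod (I : Type) (A : I -> algebra) (h : nat -> prod_algebra A) s i :
  eval h s i = eval (fun n => h n i) s.
Proof. by elim: s => //= s1 IH1 s2 IH2; rewrite IH1 IH2. Qed.

(** The algebras satisfying [e] form a variety, which contains R12 and therefore all of [V12]. *)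
Lemma V12_satisfies (A : algebra) e : V12 A -> satisfies R12 e -> satisfies A e.
Proof.
move=> VA; apply: (VA (fun B => satisfies B e)); split.
- move=> {VA}A B f fhom fsurj Ae h.
  have [k kE] := choice (fun n => fsurj (h n)).
  have -> : h = f \o k by apply/funext => n /=; rewrite kE.
  by rewrite -!eval_hom // Ae.
- move=> {VA}A B f fhom finj Ae h.
  by apply: finj; rewrite !eval_hom.
- move=> I {VA}A Ae h; apply: functional_extensionality_dep => i.
  by rewrite !eval_prod Ae.
Qed.

Fixpoint quadratic (s : term) : bool :=
  match s with
  | Var _ | Mul (Var _) (Var _) => true
  | Add s1 s2 => quadratic s1 && quadratic s2
  | Mul _ _ => false
  end.

Lemma quadratic_rhs f : quadratic (rhs f). Proof. by case: f. Qed.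
Lemma quadratic_query f : quadratic (query f). Proof. by case: f. Qed.

Definition le (A : algebra) (x y : A) : Prop := addA x y = y.

Definition horn_below (A : algebra) (T : A) : ident -> Prop :=
  horn (fun x => le x T) (fun x y => le (mulA x y) T).

Section V12.

Variables (A : algebra) (VA : V12 A).

Local Open Scope term_scope.

Lemma addAA (x y z : A) : addA x (addA y z) = addA (addA x y) z.
Proof.
have E : satisfies R12 (Var 0 + (Var 1 + Var 2), Var 0 + Var 1 + Var 2).
  by move=> h /=; case: (h 0) (h 1) (h 2) => [] [] [].
exact: (V12_satisfies VA E (nth x [:: x; y; z])).
Qed.

Lemma addAC (x y : A) : addA x y = addA y x.
Proof.
have E : satisfies R12 (Var 0 + Var 1, Var 1 + Var 0).
  by move=> h /=; case: (h 0) (h 1) => [] [].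
exact: (V12_satisfies VA E (nth x [:: x; y])).
Qed.

Lemma addAxx (x : A) : addA x x = x.
Proof.
have E : satisfies R12 (Var 0 + Var 0, Var 0) by move=> h /=; case: (h 0).
exact: (V12_satisfies VA E (nth x [:: x])).
Qed.

Lemma mulAC (x y : A) : mulA x y = mulA y x.
Proof.
have E : satisfies R12 (Var 0 * Var 1, Var 1 * Var 0).
  by move=> h /=; case: (h 0) (h 1) => [] [].
exact: (V12_satisfies VA E (nth x [:: x; y])).
Qed.

Lemma le_square (x y : A) : le x (mulA y y).
Proof.
have E : satisfies R12 (absorbs (Var 0) (Var 1 * Var 1)).
  by move=> h /=; case: (h 0) (h 1) => [] [].
exact: (V12_satisfies VA E (nth x [:: x; y])).
Qed.

Lemma le_path3 (a b c d : A) :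
  le (mulA a d)
     (addA (addA a d) (addA (addA (mulA a b) (mulA b c)) (mulA c d))).
Proof.
have E : satisfies R12 (absorbs (Var 0 * Var 3) (Var 0 + Var 3 +
    (Var 0 * Var 1 + Var 1 * Var 2 + Var 2 * Var 3))).
  by move=> h /=; case: (h 0) (h 1) (h 2) (h 3) => [] [] [] [].
exact: (V12_satisfies VA E (nth a [:: a; b; c; d])).
Qed.

Lemma le_refl (x : A) : le x x. Proof. exact: addAxx. Qed.

Lemma le_trans (y x z : A) : le x y -> le y z -> le x z.
Proof. by rewrite /le => xy yz; rewrite -yz addAA xy. Qed.

Lemma le_anti (x y : A) : le x y -> le y x -> x = y.
Proof. by rewrite /le => xy yx; rewrite -{1}yx addAC. Qed.

Lemma le_add (x y z : A) : le (addA x y) z <-> le x z /\ le y z.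
Proof.
split=> [h|[hx hy]]; last by rewrite /le -addAA hy.
split; apply: le_trans h; rewrite /le; first by rewrite addAA addAxx.
by rewrite addAC -addAA addAxx.
Qed.

Lemma holds_eval (T : A) (h : nat -> A) s : quadratic s ->
  holds (fun x => le x T) (fun x y => le (mulA x y) T) h s <->
  le (eval h s) T.
Proof.
elim: s => //= [s1 IH1 s2 IH2 /andP[/IH1 E1 /IH2 E2]|s1 _ s2 _].
  by rewrite le_add E1 E2.
by case: s1 => // i; case: s2.
Qed.

Lemma satisfies_ident_eq f : satisfies A (ident_eq f) <->
  forall h : nat -> A, le (eval h (query f)) (eval h (rhs f)).
Proof.
have sqE (v : term) : satisfies A (Var 0 * Var 0, v) <->
    forall h : nat -> A, le (eval h (Var 0 * Var 0)) (eval h v).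
  split=> H h; first by have /= -> := H h; apply: le_refl.
  by apply: le_anti => //; apply: le_square.
case: f => //; try exact: sqE.
split=> H h; first by have /= -> := H h; apply: le_refl.
(* For [i_tau], exchanging the two variables gives the reverse inequality. *)
by apply: le_anti => /=; [have := H (nth (h 0) [:: h 1; h 0])|have := H h].
Qed.

(** One direction is transitivity of [le]; for the other, take [T] to be the value of the right
    side. *)
Lemma satisfies_horn f :
  satisfies A (ident_eq f) <-> forall T : A, horn_below T f.
Proof.
rewrite satisfies_ident_eq; split=> H.
  move=> T h /(holds_eval _ _ (quadratic_rhs f)) hT.
  by apply/(holds_eval _ _ (quadratic_query f))/(le_trans (H h)).
move=> h; apply/(holds_eval _ _ (quadratic_query f))/H.
exact/(holds_eval _ _ (quadratic_rhs f))/le_refl.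
Qed.

Lemma rule_closed_satisfies :
  rule_closed [set f | `[< satisfies A (ident_eq f) >]].
Proof.
apply/allP => r rR; apply/implyP => /allP r1; apply/allP => g gr.
rewrite inE; apply/asboolP/satisfies_horn => T.
apply: (horn_rules _ _ _ _ rR _ gr)
  => [x y|x xx|a b c d aT dT ab bc cd|triv x y|f fr].
- by rewrite mulAC.
- by split=> [y|y z]; apply: le_trans xx; apply: le_square.
- by apply: le_trans (le_path3 a b c d) _; rewrite !le_add.
- by apply: (triv T); apply: le_refl.
- by have := r1 _ fr; rewrite inE => /asboolP/satisfies_horn; apply.
Qed.

End V12.

Lemma rule_closure_entails E f : f \in rule_closure E -> entails E f.
Proof.
move=> /bigcapP fE A VA AE.
have /fE : (E \subset [set f | `[< satisfies A (ident_eq f) >]]) &&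
    rule_closed [set f | `[< satisfies A (ident_eq f) >]].
  rewrite rule_closed_satisfies // andbT; apply/subsetP => g gE.
  by rewrite inE; apply/asboolP/AE.
by rewrite inE => /asboolP.
Qed.

(** * Deciding Horn clauses on finite graphs *)

Fixpoint vars (s : term) : seq nat :=
  match s with
  | Var i => [:: i]
  | Add s1 s2 | Mul s1 s2 => vars s1 ++ vars s2
  end.

Fixpoint atoms (s : term) : seq term :=
  if s is Add s1 s2 then atoms s1 ++ atoms s2 else [:: s].

Definition edge_vars (s : term) : seq nat :=
  flatten [seq if a is Mul _ _ then vars a else [::] | a <- atoms s].

Lemma vars_query f : f != i_tau -> {subset vars (query f) <= vars (rhs f)}.
Proof. by move=> ft; apply/allP; case: f ft. Qed.

(** No right side has an isolated vertex. In [horn_sat] this forces every variable to take a value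
    with nonempty support. *)
Lemma vars_rhs f : f != i_tau -> {subset vars (rhs f) <= edge_vars (rhs f)}.
Proof. by move=> ft; apply/allP; case: f ft. Qed.

Definition update (phi : nat -> nat) i v j := if j == i then v else phi j.

Section BoolHorn.

Variables (n : nat) (mk : pred nat) (ad : rel nat).

Fixpoint holdsb (phi : nat -> nat) (s : term) : bool :=
  match s with
  | Var i => mk (phi i)
  | Add s1 s2 => holdsb phi s1 && holdsb phi s2
  | Mul (Var i) (Var j) => ad (phi i) (phi j)
  | Mul _ _ => false
  end.

Lemma holdsbP phi s : holds mk ad phi s <-> holdsb phi s.
Proof.
elim: s => //= [s1 E1 s2 E2|s1 _ s2 _]; last by case: s1 => // i; case: s2.
by rewrite E1 E2; split=> [|/andP] // [-> ->].
Qed.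

(* Once all variables of an atom are bound, a false atom prunes the branch. The
   conditional is not written as [||], of which vm_compute evaluates both sides. *)
Fixpoint search (q : term) (ps : seq term) (bs : seq nat) (phi : nat -> nat) :=
  if bs is i :: bs' then
    all (fun v => let phi' := update phi i v in
         if has (fun a => ~~ has (mem bs') (vars a) && ~~ holdsb phi' a) ps
         then true else search q ps bs' phi') (iota 0 n)
  else all (holdsb phi) ps ==> holdsb phi q.

Definition hornb (f : ident) : bool :=
  search (query f) (atoms (rhs f))
    (rev (undup (vars (query f) ++ vars (rhs f)))) (fun=> 0).

Lemma holdsb_atoms phi s : holdsb phi s = all (holdsb phi) (atoms s).
Proof.
elim: s => [i|s1 IH1 s2 IH2|s1 _ s2 _] /=; rewrite ?andbT //.
by rewrite all_cat IH1 IH2.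
Qed.

Lemma eq_holdsb phi psi s : {in vars s, phi =1 psi} -> holdsb phi s = holdsb psi s.
Proof.
elim: s => /= [i|s1 IH1 s2 IH2|s1 _ s2 _] E; first by rewrite E ?inE.
  by rewrite IH1 ?IH2 // => i iV; apply: E; rewrite mem_cat iV ?orbT.
case: s1 E => // i; case: s2 => // j E.
by rewrite !E // !inE eqxx ?orbT.
Qed.

Lemma searchP q ps bs phi psi : search q ps bs phi ->
  (forall i, psi i < n) -> (forall i, i \notin bs -> phi i = psi i) ->
  all (holdsb psi) ps -> holdsb psi q.
Proof.
elim: bs phi => [|i bs IH] phi /= S ltn E hp.
  have {}E : forall s, holdsb psi s = holdsb phi s.
    by move=> s; apply: eq_holdsb => i _; rewrite E.
  by rewrite E; apply: (implyP S); rewrite -(eq_all (fun s => E s)).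
move/allP/(_ (psi i)): S; rewrite mem_iota ltn => /(_ isT).
have {}E j : j \notin bs -> update phi i (psi i) j = psi j.
  rewrite /update; case: eqP => [-> //|/eqP ji jb].
  by apply: E; rewrite inE negb_or ji.
case: ifP => [hn _|_ /IH]; last by apply.
suff : has (predC (holdsb psi)) ps by rewrite has_predC hp.
apply: sub_has hn => a /andP[/hasPn av]; rewrite /= (eq_holdsb (psi := psi)) //.
by move=> j /av; apply: E.
Qed.

Lemma searchPn q ps bs phi : ~~ search q ps bs phi ->
  exists2 psi, all (holdsb psi) ps & ~~ holdsb psi q.
Proof.
elim: bs phi => [|i bs IH] phi /=; first by rewrite negb_imply => /andP[]; exists phi.
by case/allPn=> v _; case: ifP => // _ /IH.
Qed.

Lemma hornPn f : ~~ hornb f -> ~ horn mk ad f.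
Proof.
case/searchPn=> psi; rewrite -holdsb_atoms => hr hq H.
by move/holdsbP: hr => /H/holdsbP; rewrite (negPf hq).
Qed.

Hypothesis mk_lt : forall x, mk x -> x < n.
Hypothesis ad_lt : forall x y, ad x y -> x < n /\ y < n.

Lemma holdsb_lt psi s i : holdsb psi s -> i \in vars s -> psi i < n.
Proof.
elim: s => /= [j|s1 IH1 s2 IH2|s1 _ s2 _].
- by move=> /mk_lt jn; rewrite inE => /eqP->.
- by case/andP=> /IH1 H1 /IH2 H2; rewrite mem_cat => /orP[].
- case: s1 => // j; case: s2 => // k /ad_lt[jn kn].
  by rewrite !inE => /orP[] /eqP->.
Qed.

Lemma hornP f : f != i_tau -> hornb f -> horn mk ad f.
Proof.
move=> ft S psi /holdsbP hr; apply/holdsbP.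
(* The search starts from the zero assignment, so the other variables are reset to 0. This value is
   below [n] because the right side has some variable, whose value is below [n]. *)
pose psi0 i := if i \in vars (rhs f) then psi i else 0.
have E s : {subset vars s <= vars (rhs f)} -> holdsb psi s = holdsb psi0 s.
  by move=> sV; apply: eq_holdsb => i /sV; rewrite /psi0 => ->.
rewrite E; last exact: vars_query.
apply: (searchP S).
- move=> i; rewrite /psi0; case: ifP => [|_]; first exact: holdsb_lt hr.
  apply: leq_ltn_trans (leq0n (psi (head 0 (vars (rhs f))))) (holdsb_lt hr _).
  by case: (f).
- by move=> i; rewrite mem_rev mem_undup mem_cat negb_or /psi0 => /andP[_ /negPf->].
- by rewrite -holdsb_atoms -E.
Qed.

End BoolHorn.

(** * Algebras from families of assignments *)

Definition sub_algebra (A : algebra) (S : A -> Prop)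
    (SD : forall x y, S x -> S y -> S (addA x y))
    (SM : forall x y, S x -> S y -> S (mulA x y)) : algebra :=
  @Algebra {x | S x}
    (fun x y => exist _ _ (SD _ _ (svalP x) (svalP y)))
    (fun x y => exist _ _ (SM _ _ (svalP x) (svalP y))).

Lemma sval_inj (T : Type) (S : T -> Prop) : injective (@sval T S).
Proof. by move=> [x Sx] [y Sy] /= xy; apply: eq_exist. Qed.

Lemma variety_sub_algebra K (A : algebra) S SD SM :
  variety K -> K A -> K (@sub_algebra A S SD SM).
Proof.
move=> [_ KS _]; apply: (KS _ _ (fun x : sub_algebra SD SM => sval x)) => //.
exact: sval_inj.
Qed.

Notation lec x := (R12_leb x Rc).

Lemma lecD x y : lec (R12_add x y) = lec x && lec y.
Proof. by case: x y => [] []. Qed.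


(** [Quad b] is a collapsed nonlinear tuple, remembering only whether all its entries lie below c:
    [Quad true] plays the role of c and [Quad false] that of 0. *)
Inductive model_elt (J : Type) := Lin of J -> R12_elt | Quad of bool.
Arguments Quad {J}.

Section Model.

Variable J : finType.

Implicit Types (u w : J -> R12_elt).

Definition in_ideal u := [forall j, lec (u j)].

Definition model_add (x y : model_elt J) : model_elt J :=
  match x, y with
  | Lin u, Lin w => Lin (fun j => R12_add (u j) (w j))
  | Lin u, Quad b | Quad b, Lin u => Quad (in_ideal u && b)
  | Quad b, Quad b' => Quad (b && b')
  end.

Definition model_mul (x y : model_elt J) : model_elt J :=
  match x, y with
  | Lin u, Lin w => Quad (in_ideal (fun j => R12_mul (u j) (w j)))
  | _, _ => Quad false
  end.

Definition model : algebra := @Algebra (model_elt J) model_add model_mul.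

Lemma in_idealD u w :
  in_ideal (fun j => R12_add (u j) (w j)) = in_ideal u && in_ideal w.
Proof.
apply/forallP/andP => [H|[/forallP Hu /forallP Hw] j]; last by rewrite lecD Hu Hw.
by split; apply/forallP => j; have := H j; rewrite lecD => /andP[].
Qed.

(* [model] is the image of the subalgebra of R12^(1+J) formed by the tuples
   starting with p, which go to [Lin], and by those starting with 0 whose other
   entries are c or 0, which are collapsed by the ideal of c. *)
Definition presentable (x : option J -> R12_elt) : Prop :=
  x None = Rp \/ x None = R0 /\ forall j, R12_leb Rc (x (Some j)).

Lemma V12_model : 0 < #|J| -> V12 model.
Proof.
case/card_gt0P=> j0 _ K VK KR; have [KH _ KP] := VK.
pose P := prod_algebra (fun _ : option J => R12).
have SD (x y : P) : presentable x -> presentable y -> presentable (addA x y).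
  rewrite /presentable /=.
  case=> [->|[-> hx]] [->|[-> hy]]; [by left|right; split=> // j..].
  - by have := hy j; case: (x _) (y _) => [] [].
  - by have := hx j; case: (x _) (y _) => [] [].
  - by have := hx j; case: (x _) (y _) => [] [].
have SM (x y : P) : presentable x -> presentable y -> presentable (mulA x y).
  rewrite /presentable /= => hx hy; right; split.
    by case: hx hy => [->|[-> _]] [->|[-> _]].
  by move=> j; case: (x _) (y _) => [] [].
have KPP : K P by apply: KP => _.
pose S := sub_algebra SD SM.
pose f (x : S) : model :=
  if sval x None is Rp then Lin (fun j => sval x (Some j))
  else Quad (in_ideal (fun j => sval x (Some j))).
(* Since c and 0 annihilate everything to 0, a product with a nonlinear tuple leaves the ideal at
   the coordinate [j0] and becomes [Quad false]. *)
have mul0 a b : R12_leb Rc a -> ~~ lec (R12_mul a b).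
  by case: a b => [] [].
apply: (KH S model f); last exact: (variety_sub_algebra SD SM VK KPP).
- split=> - [x hx] [y hy]; rewrite /f /=.
    case: (hx) => [->|[-> _]]; case: (hy) => [->|[-> _]] //=;
      by rewrite in_idealD // andbC.
  case: hx => [->|[-> hx]]; case: hy => [->|[-> hy]] //=; congr Quad;
    apply/negbTE/forallPn; exists j0; try by apply: mul0.
  by have := hy j0; case: (x _) (y _) => [] [].
- case=> [u|b].
    have h : presentable (oapp u Rp) by left.
    by exists (exist _ (oapp u Rp : P) h).
  have h : presentable (oapp (fun=> if b then Rc else R0) R0).
    by right; split=> // j; case: b.
  exists (exist _ (oapp (fun=> if b then Rc else R0) R0 : P) h).
  rewrite /f /=; congr Quad; case: b {h}; first by apply/forallP.
  by apply/negbTE/forallPn; exists j0.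
Qed.

(** * The subalgebra generated by the vertices of a graph *)

Variable g : nat -> J -> R12_elt.

(** The sum must be nonempty, as the language has no constants; hence the separate first summand
    [x]. *)
Definition span x s (j : J) : R12_elt := foldr (fun y => R12_add (g y j)) (g x j) s.

Definition spanned (a : model) : Prop :=
  if a is Lin u then exists x s, u = span x s else True.

Definition gmark x := in_ideal (g x).
Definition gadj x y := in_ideal (fun j => R12_mul (g x j) (g y j)).

Lemma in_ideal_span x s : in_ideal (span x s) = all gmark (x :: s).
Proof.
elim: s => [|y s IH] /=; first by rewrite andbT.
by rewrite [LHS](in_idealD (g y) (span x s)) IH /= andbCA.
Qed.

Lemma span_cat x s y t :
  span y (s ++ x :: t) = (fun j => R12_add (span x s j) (span y t j)).
Proof.
apply/funext => j; rewrite /span foldr_cat /=.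
have addA a b c : R12_add a (R12_add b c) = R12_add (R12_add a b) c.
  by case: a b c => [] [] [].
by elim: s => //= z s ->.
Qed.

(** By distributivity and because a sum lies below c exactly when its summands do, products of sums
    are decided on pairs of generators. *)
Lemma in_ideal_mul x s y t :
  in_ideal (fun j => R12_mul (span x s j) (span y t j)) =
  all (fun a => all (gadj a) (y :: t)) (x :: s).
Proof.
have D a b c : lec (R12_mul (R12_add a b) c) = lec (R12_mul a c) && lec (R12_mul b c).
  by case: a b c => [] [] [].
have C a b : R12_mul a b = R12_mul b a by case: a b => [] [].
have L u v w : in_ideal (fun j => R12_mul (R12_add (u j) (v j)) (w j)) =
    in_ideal (fun j => R12_mul (u j) (w j)) &&
    in_ideal (fun j => R12_mul (v j) (w j)).
  rewrite -in_idealD; apply/eq_forallb => j; by rewrite D lecD.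
have R u v w : in_ideal (fun j => R12_mul (u j) (R12_add (v j) (w j))) =
    in_ideal (fun j => R12_mul (u j) (v j)) &&
    in_ideal (fun j => R12_mul (u j) (w j)).
  by rewrite -in_idealD; apply/eq_forallb => j; rewrite C D lecD !(C (u j)).
have M a : in_ideal (fun j => R12_mul (g a j) (span y t j)) = all (gadj a) (y :: t).
  elim: t => [|z t IH]; first by rewrite /= andbT.
  by rewrite [LHS](R (g a) (g z) (span y t)) IH /= andbCA.
elim: s => [|z s IH]; first by rewrite /= andbT M.
by rewrite [LHS](L (g z) (span x s) (span y t)) IH M /= andbCA.
Qed.

Lemma spannedD (a b : model) : spanned a -> spanned b -> spanned (addA a b).
Proof.
case: a b => [u|b] [w|b'] //= [x [s ->]] [y [t ->]].
by exists y, (s ++ x :: t); rewrite span_cat.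
Qed.

Lemma spannedM (a b : model) : spanned a -> spanned b -> spanned (mulA a b).
Proof. by case: a b => [u|b] [w|b']. Qed.

Definition span_model : algebra := sub_algebra spannedD spannedM.

Hypothesis J_gt0 : 0 < #|J|.

Lemma V12_span_model : V12 span_model.
Proof.
by move=> K VK KR; apply: (variety_sub_algebra _ _ VK (V12_model J_gt0 VK KR)).
Qed.

Lemma gadj_irr x : gadj x x = false.
Proof.
case/card_gt0P: J_gt0 => j _; apply/negbTE/forallPn; exists j.
by case: (g x j).
Qed.

Definition c_elt : span_model := exist spanned (Quad true) I.

Definition gen x : span_model :=
  exist spanned (Lin (g x)) (ex_intro _ x (ex_intro _ [::] erefl)).

Lemma le_c_elt (a : span_model) :
  le a c_elt <-> match sval a with Lin u => in_ideal u | Quad b => b end.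
Proof.
have -> : le a c_elt <-> addA (sval a) (Quad true) = Quad true.
  by split=> [/(congr1 sval)|h]; last exact: sval_inj.
by case: (sval a) => [u|b] /=; rewrite andbT; split=> [[]|->].
Qed.

Lemma le_c_mul_gen x y : le (mulA (gen x) (gen y)) c_elt <-> gadj x y.
Proof. exact: le_c_elt. Qed.

(** It suffices to take [T] to be [c_elt] and to assign generators to the variables. *)
Lemma sat_horn f : satisfies span_model (ident_eq f) -> horn gmark gadj f.
Proof.
move/(satisfies_horn V12_span_model)/(_ c_elt) => H phi.
have E s : quadratic s -> holds (fun x : span_model => le x c_elt)
    (fun x y => le (mulA x y) c_elt)
    (gen \o phi) s <-> holds gmark gadj phi s.
  elim: s => [i|s IHs t IHt /= /andP[/IHs-> /IHt->] //|s _ t _].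
    by move=> _; apply: le_c_elt.
  by case: s => // i; case: t => // j _; apply: le_c_mul_gen.
by move/(E _ (quadratic_rhs f))/H/(E _ (quadratic_query f)).
Qed.

(** The support of a linear element lists generators summing to it, and that of a [Quad] is empty.
    Comparison with [c_elt] is thereby expressed by the graph. *)
Lemma supports : exists supp : span_model -> seq nat, forall a,
  (le a c_elt -> all gmark (supp a)) /\
  (supp a != [::] -> all gmark (supp a) -> le a c_elt) /\
  forall b, le (mulA a b) c_elt <-> [&& supp a != [::], supp b != [::] &
     all (fun x => all (gadj x) (supp b)) (supp a)].
Proof.
have /choice[supp suppP] (a : span_model) : exists l : seq nat,
    if sval a is Lin u then exists x s, l = x :: s /\ u = span x s else l = [::].
  case: a => [[u|b] /= ha]; last by exists [::].
  by case: ha => x [s ->]; exists (x :: s), x, s.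
exists supp => a; have := suppP a.
case: a => [[u|b] ha]; set a : span_model := exist _ _ ha => /=; last first.
  by move=> ->; split=> //; split=> // b'; rewrite le_c_elt /=; case: (sval b').
case=> x [s [sE uE]].
have aE : le a c_elt <-> all gmark (supp a) by rewrite le_c_elt sE -in_ideal_span -uE.
split; [by move/aE|split; [by move=> _ /aE|]] => b.
rewrite le_c_elt sE /=; have := suppP b.
case: (sval b) => [w|b']; last by move=> ->.
by case=> y [t [-> ->]] /=; rewrite uE in_ideal_mul.
Qed.

Lemma holds_edge_vars (T : Type) (m : T -> Prop) e phi s i :
  holds m e phi s -> i \in edge_vars s ->
  exists j, e (phi i) (phi j) \/ e (phi j) (phi i).
Proof.
rewrite /edge_vars.
elim: s => //= [s IHs t IHt [/IHs Hs /IHt Ht]|s _ t _].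
  by rewrite map_cat flatten_cat mem_cat => /orP[].
case: s => // j; case: t => // k h; rewrite cats0 !inE => /orP[] /eqP->.
  by exists k; left.
by exists j; right.
Qed.

Lemma query_shape f : (exists i, query f = Var i) \/
  exists i j, query f = Mul (Var i) (Var j).
Proof.
by case: f; (left; eexists; reflexivity) || (right; do 2!eexists; reflexivity).
Qed.

(** Some product lies below [T], so [T] is a [Quad]. When it is [c_elt], choose one generator in the
    support of each value: the clause holds for every choice, and letting the choice vary at the
    variables of the query gives the query for the sums. *)
Lemma horn_sat f : f != i_tau -> horn gmark gadj f ->
  satisfies span_model (ident_eq f).
Proof.
move=> ft H; apply/(satisfies_horn V12_span_model) => T phi hr.
have [i0 i0V] : exists i, i \in vars (rhs f).
  by exists (head 0 (vars (rhs f))); case: (f).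
have QT a b : le (mulA a b) T -> exists b', sval T = Quad b'.
  move/(congr1 sval); case: T {hr} => [[u|b'] hT] /=; last by exists b'.
  by case: (sval a) (sval b) => [?|?] [?|?].
have [b Tb] : exists b, sval T = Quad b.
  by have [j [/QT|/QT]] := holds_edge_vars hr (vars_rhs ft i0V).
(* [Quad false] is the greatest element, so every query lies below it. *)
case: b Tb => Tb; last first.
  have le0 (a : span_model) : le a T.
    by apply: sval_inj => /=; rewrite Tb; case: (sval a) => ? /=; rewrite andbF.
  by case: (query_shape f) => [[i ->]|[i [j ->]]]; apply: le0.
have {QT Tb} ET : T = c_elt by apply: sval_inj.
rewrite {T}ET in hr *.
have [supp suppP] := supports.
have supp0 i : i \in vars (rhs f) -> supp (phi i) != [::].
  move=> /(vars_rhs ft) /(holds_edge_vars hr)[j [|]];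
    by case/(suppP _).2.2/and3P.
have sel psi : (forall i, i \in vars (rhs f) -> psi i \in supp (phi i)) ->
    holds gmark gadj psi (query f).
  move=> psiP; apply: H; elim: (rhs f) psiP hr => [i|s IHs t IHt|s _ t _] /= psiP.
  - by move/(suppP _).1/allP; apply; apply: psiP; rewrite inE.
  - case=> /IHs Hs /IHt Ht; split; [apply: Hs|apply: Ht] => i iV; apply: psiP;
      by rewrite mem_cat iV ?orbT.
  - case: s psiP => // i; case: t => // j psiP /(suppP _).2.2/and3P[_ _ /allP h].
    have /allP := h _ (psiP i (mem_head _ _)); apply; apply: psiP.
    by rewrite !inE eqxx orbT.
pose psi0 i := head 0 (supp (phi i)).
have psi0P i : i \in vars (rhs f) -> psi0 i \in supp (phi i).
  by move/supp0; rewrite /psi0; case: (supp _) => //= x s _; rewrite mem_head.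
have upd psi i x : (forall i, i \in vars (rhs f) -> psi i \in supp (phi i)) ->
    x \in supp (phi i) ->
    forall j, j \in vars (rhs f) -> update psi i x j \in supp (phi j).
  by move=> psiP xs j jV; rewrite /update; case: eqP => [->|_]; last exact: psiP.
have qV := vars_query ft.
case: (query_shape f) => [[i qE]|[i [j qE]]]; rewrite qE /= in sel qV *.
  have iV : i \in vars (rhs f) by apply: qV; rewrite inE.
  apply: (suppP _).2.1 (supp0 _ iV) _; apply/allP => x xs.
  by have := sel _ (upd _ i x psi0P xs); rewrite /update eqxx.
have iV : i \in vars (rhs f) by apply: qV; rewrite inE eqxx.
have jV : j \in vars (rhs f) by apply: qV; rewrite !inE eqxx orbT.
(* If the query is a square, the graph clause would give a loop, which [gadj_irr] excludes. *)
have [ij|ij] := eqVneq i j.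
  by have := sel _ psi0P; rewrite ij gadj_irr.
apply/(suppP _).2.2/and3P; split; rewrite ?supp0 //.
apply/allP => x xs; apply/allP => y ys.
have := sel _ (upd _ j y (upd _ i x psi0P xs) ys).
by rewrite /update eqxx (negPf ij) eqxx.
Qed.

End Model.

(** * Graphs given by explicit lists of assignments *)

Section Family.

Variable fam : seq (seq R12_elt).

Definition fam_mark x := all (fun h => lec (nth R0 h x)) fam.
Definition fam_adj x y := all (fun h => lec (R12_mul (nth R0 h x) (nth R0 h y))) fam.

Definition fam_gen x (j : 'I_(size fam)) := nth R0 (nth [::] fam j) x.
Definition fam_model := span_model fam_gen.

Hypothesis fam0 : 0 < size fam.

Lemma in_ideal_fam (p : seq R12_elt -> R12_elt) :
  in_ideal (fun j : 'I_(size fam) => p (nth [::] fam j)) =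
  all (fun h => lec (p h)) fam.
Proof.
apply/forallP/(all_nthP [::]) => H i; last exact: H.
by move=> ilt; apply: (H (Ordinal ilt)).
Qed.

Lemma V12_fam_model : V12 fam_model.
Proof. by apply: V12_span_model; rewrite card_ord. Qed.

Lemma fam_markE x : gmark fam_gen x = fam_mark x.
Proof. exact: (in_ideal_fam (nth R0 ^~ x)). Qed.

Lemma fam_adjE x y : gadj fam_gen x y = fam_adj x y.
Proof. exact: (in_ideal_fam (fun h => R12_mul (nth R0 h x) (nth R0 h y))). Qed.

Lemma fam_horn f :
  horn (gmark fam_gen) (gadj fam_gen) f <-> horn fam_mark fam_adj f.
Proof.
have -> : gmark fam_gen = fam_mark by apply/funext => x; rewrite fam_markE.
have -> // : gadj fam_gen = fam_adj.
by apply/funext => x; apply/funext => y; rewrite fam_adjE.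
Qed.

(** A vertex past the end of the assignments gets the default 0, which is neither marked nor
    adjacent to anything; so searching the first [n] vertices is exhaustive. *)
Lemma fam_sat f n : all (fun h => size h <= n) fam -> f != i_tau ->
  hornb n fam_mark fam_adj f -> satisfies fam_model (ident_eq f).
Proof.
move=> fn ft fb; apply: horn_sat; rewrite ?card_ord //.
have {fn}[lt_mk lt_ad] : (forall x, fam_mark x -> x < n) /\
    forall x y, fam_adj x y -> x < n /\ y < n.
  rewrite /fam_mark /fam_adj; case: (fam) fam0 fn => //= h l _ /andP[hn _].
  have out x : n <= x -> nth R0 h x = R0.
    by move=> nx; rewrite nth_default // (leq_trans hn).
  split=> [x|x y] /andP[+ _].
    by rewrite ltnNge => hx; apply/negP => /out E; move: hx; rewrite E.
  move=> xy; split; rewrite ltnNge; apply/negP => /out E; move: xy; rewrite E //.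
  by case: nth.
by apply/fam_horn; apply: hornP fb.
Qed.

End Family.

(** * Separating models *)

Definition derive_step (F : seq ident) : seq ident :=
  undup (F ++ flatten [seq r.2 | r <- rules & all (mem F) r.1]).

(** Any number of rounds is sound by [derive_sub]; 12 are enough for the computations below. *)
Definition derive (F : seq ident) : seq ident := iter 12 derive_step F.

Lemma derive_sub (F : {set ident}) s : rule_closed F ->
  {subset s <= F} -> {subset derive s <= F}.
Proof.
move=> /allP FC; rewrite /derive; elim: 12 => //= k IH sF f.
rewrite mem_undup mem_cat => /orP[/IH|/flatten_mapP[r]]; first exact.
rewrite mem_filter => /andP[/allP r1 rR] fr.
have /implyP/(_ _)/allP := FC _ rR; apply=> //.
by apply/allP => g /r1 /(IH sF).
Qed.

Definition violated (out : seq ident) (r : seq ident * seq ident) : bool :=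
  has (mem out) r.2 && ~~ has (mem out) r.1.

(** [out] collects identities missing from a closed set. A rule with a conclusion in [out] but no
    premise there forces some premise out as well, and the search branches on which one. At a leaf
    no rule is violated, so the complement of [out] is closed. *)
Fixpoint refutable (rs : seq (seq ident * seq ident)) (k : nat)
    (leaf : pred (seq ident)) (out : seq ident) : bool :=
  if k is k'.+1 then
    if has (violated out) rs then
      all (fun g => refutable rs k' leaf (g :: out))
        (nth ([::], [::]) rs (find (violated out) rs)).1
    else leaf out
  else false.

Lemma refutableP rs k leaf out (F : {set ident}) :
  {subset rs <= rules} -> rule_closed F ->
  refutable rs k leaf out -> all (fun g => g \notin F) out ->
  exists2 out', leaf out' & all (fun g => g \notin F) out'.
Proof.
move=> rsR FC; elim: k out => //= k IH out.
case: ifP => [hb|_ lo oF]; last by exists out.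
set r := nth _ _ _; move=> /allP S oF.
have rR : r \in rules by apply/rsR/mem_nth; rewrite -has_find.
have /andP[/hasP[f fr fo] _] : violated out r by apply: nth_find.
have /allPn[g gr gF] : ~~ all (fun e => e \in F) r.1.
  apply: contraL (allP oF _ fo) => r1; rewrite negbK.
  by have /implyP/(_ r1)/allP := allP FC _ rR; apply.
by apply: (IH (g :: out)); [exact: S|rewrite /= gF].
Qed.

(* Each entry consists of a family of assignments, where [nth R0 h i] is the value
   of vertex [i], of identities generating under the rules all those that hold in
   the graph, and of identities that fail. The graphs are the closures of the right
   sides of failing identities. *)
Definition models : seq (seq (seq R12_elt) * seq ident * seq ident) :=
  [::
    ([:: [:: Rq; Ra; Rb; Rp]],
     [::], [:: i_epsilon]);
    ([:: [:: Rq; Ra; Rb; Rp]; [:: Ra; Rb; Rp; Rb]],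
     [:: i_gamma_1; i_mu_2], [:: i_kappa]);
    ([:: [:: Rp; Rb; Ra; Rq]; [:: Rq; Ra; Rb; Rp]],
     [:: i_alpha], [:: i_mu_2]);
    ([:: [:: Rp; Rb; Rp; Rb; Rq; Ra]; [:: Rp; Rb; Ra; Rq; Ra; Rq]],
     [:: i_eta], [:: i_mu_D; i_alpha_D; i_iota_2_D; i_gamma_1_D]);
    ([:: [:: Rp; Rb; Rp; Rb; Rq; Ra]; [:: Rq; Ra; Rb; Rp; Rq; Ra]],
     [:: i_alpha; i_lambda], [:: i_mu_D; i_iota_2_D]);
    ([:: [:: Rp; Rb; Rp; Rb; Ra; Rq; Rq; Ra];
         [:: Ra; Rq; Ra; Rb; Rp; Rb; Rq; Ra];
         [:: Rb; Ra; Rb; Rp; Rb; Rp; Rq; Ra]],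
     [:: i_lambda; i_mu], [:: i_iota_2_D]);
    ([:: [:: Rq; Ra; Rb; Rp; Rq; Ra];
         [:: Ra; Rb; Rp; Rb; Rq; Ra];
         [:: Rb; Rp; Rb; Rp; Rq; Ra]],
     [:: i_iota_2; i_lambda], [:: i_alpha_D]);
    ([:: [:: Rb; Ra; Rp]],
     [:: i_delta], [:: i_lambda]);
    ([:: [:: Rp; Rb; Rp; Rb]; [:: Rp; Rb; Ra; Rq]],
     [:: i_eta; i_xi], [:: i_mu; i_alpha; i_iota_2; i_gamma_1]);
    ([:: [:: Rq; Ra; Ra; Rb; Rp]; [:: Rq; Ra; Rb; Rp; Rb]],
     [:: i_delta; i_lambda], [:: i_eta_D]);
    ([:: [:: Rp; Rb; Rp; Rb]; [:: Rq; Ra; Rb; Rp]],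
     [:: i_alpha; i_beta], [:: i_mu; i_iota_2]);
    ([:: [:: Rp; Rb; Rp; Rb; Rq; Ra];
         [:: Rp; Rb; Ra; Rq; Rq; Ra];
         [:: Rb; Rp; Rb; Rp; Rq; Ra]],
     [:: i_omega], [:: i_nu; i_nu_D]);
    ([:: [:: Rp; Rb; Rp; Rb; Ra; Rq];
         [:: Ra; Rq; Ra; Rb; Rp; Rb];
         [:: Rb; Ra; Rb; Rp; Rb; Rp]],
     [:: i_beta; i_mu], [:: i_iota_2]);
    ([:: [:: Rq; Ra; Rb; Rp]; [:: Ra; Rq; Rb; Rp]],
     [:: i_delta; i_eta], [:: i_omega_D]);
    ([:: [:: Rq; Ra; Rb; Rp]; [:: Ra; Rb; Rp; Rb]; [:: Rb; Rp; Rb; Rp]],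
     [:: i_beta; i_iota_2], [:: i_alpha]);
    ([:: [:: Rp; Rq; Ra; Rb]; [:: Rb; Rq; Ra; Rp]],
     [:: i_delta; i_omega], [:: i_zeta; i_zeta_D]);
    ([:: [:: Rp; Rb; Rp; Rb; Rq; Ra];
         [:: Rp; Rb; Ra; Rq; Rq; Ra];
         [:: Rb; Rp; Rb; Rp; Rb; Rp]],
     [:: i_beta; i_eta], [:: i_nu]);
    ([:: [:: Ra; Rb; Rp]; [:: Rb; Rp; Rb]],
     [:: i_beta; i_delta], [:: i_eta]);
    ([:: [:: Rq; Rb; Rp; Ra]; [:: Rb; Rq; Ra; Rp]],
     [:: i_delta; i_eta; i_xi], [:: i_beta]);
    ([:: [:: Rb; Rp]],
     [:: i_beta; i_delta; i_eta], [:: i_omega; i_zeta; i_s]);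
    ([:: [:: Rq; Ra]],
     [:: i_rho], [:: i_xi; i_beta; i_s; i_chi]);
    ([:: [:: Rp; Rb; Rp; Rb]; [:: Rp; Rb; Ra; Rq]; [:: Rb; Rp; Rb; Rp]],
     [:: i_s], [:: i_delta]);
    ([:: [:: Rp; Rb]; [:: Rb; Rp]],
     [:: i_delta; i_s], [:: i_rho; i_chi]);
    ([:: [:: Ra; R0]],
     [:: i_chi], [:: i_tau])].

Definition model_size (fam : seq (seq R12_elt)) := foldr maxn 0 (map size fam).

Definition model_ok (M : seq (seq R12_elt) * seq ident * seq ident) :=
  let: (fam, gens, fails) := M in
  let n := model_size fam in
  [&& 0 < size fam,
      all (fun f => (f != i_tau) && hornb n (fam_mark fam) (fam_adj fam) f) gens
    & all (fun f => ~~ hornb n (fam_mark fam) (fam_adj fam) f) fails].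

Lemma models_ok : all model_ok models.
Proof. by vm_compute. Qed.

(** Only the generating identities are tested in a graph; soundness of the rules supplies the
    others. *)
Definition separators := [seq (derive M.1.2, M.2) | M <- models].

Definition separated f (out : seq ident) : bool :=
  has (fun S => (f \in S.2) && all (fun g => (g \in out) || (g \in S.1)) all_ident)
    separators.

(** Each branching adds a new identity to [out], so the number 27 of identities bounds the depth. *)
Lemma all_refutable :
  all (fun f => refutable rules 27 (separated f) [:: f]) all_ident.
Proof. by vm_compute. Qed.

(** Following premises outside [F] leads to a leaf whose identities all miss [F]. The model attached
    to that leaf refutes [f] and satisfies every identity outside the leaf, hence all of [F]. *)
Lemma separation (F : {set ident}) f : rule_closed F -> f \notin F ->
  exists A : algebra, [/\ V12 A,
    forall g, g \in F -> satisfies A (ident_eq g) & ~ satisfies A (ident_eq f)].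
Proof.
move=> FC fF.
have fI : f \in all_ident by case: f {fF}.
have [|out sep /allP outF] := refutableP (fun r h => h) FC (allP all_refutable f fI).
  by rewrite /= fF.
have {sep}[M [ok fM /allP MF]] : exists M,
    [/\ model_ok M, f \in M.2
    & all (fun g => (g \in out) || (g \in derive M.1.2)) all_ident].
  pose M0 : seq (seq R12_elt) * seq ident * seq ident := ([::], [::], [::]).
  move: sep; rewrite /separated /separators has_map => /(has_nthP M0)[i il /andP[]].
  by exists (nth M0 models i); split=> //; apply: (all_nthP M0 models_ok).
case: M fM MF ok => [[fam gens] fails] /= fM MF /and3P[fam0 /allP gensP /allP failsP].
have size_le : all (fun h => size h <= model_size fam) fam.
  rewrite /model_size; elim: (fam) => //= h l IH; rewrite leq_maxl /=.
  by apply: sub_all IH => h' /leq_trans; apply; apply: leq_maxr.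
exists (fam_model fam); split; first exact: V12_fam_model.
  move=> g gF; apply/asboolP.
  have := derive_sub (rule_closed_satisfies (V12_fam_model fam0))
    (s := gens) _ (x := g).
  rewrite inE; apply=> [h /gensP/andP[ht hb]|].
    by rewrite inE; apply/asboolP; apply: fam_sat hb.
  have gI : g \in all_ident by case: (g).
  by have /orP[/outF|//] := MF g gI; rewrite gF.
by move/(sat_horn _)/fam_horn/(hornPn (failsP _ fM)); apply; rewrite card_ord.
Qed.

Lemma entails_rule_closure E f : entails E f -> f \in rule_closure E.
Proof.
move=> Ef; apply/bigcapP => F /andP[EF FC]; apply/negPn/negP => fF.
have [A [VA AF]] := separation FC fF; apply; apply: Ef => // g gE.
exact/AF/(subsetP EF).
Qed.

(** * Closed terms *)

Local Open Scope mset_scope.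

Definition lin (v : polynomial) (x : nat) : Prop := [mset x] \in v.
(** Unlike [edge], this allows [x = y], so that square queries are covered; the two agree when [v]
    is not basic-zero. *)
Definition quad (v : polynomial) (x y : nat) : Prop := [mset x; y] \in v.

Lemma summands_mul i j : summands (Mul (Var i) (Var j)) = [fset [mset i; j]]%fset.
Proof.
apply/fsetP => m; rewrite in_fset1; apply/imfset2P/eqP => /= [[a]|->].
  by rewrite in_fset1 => /eqP-> [b]; rewrite in_fset1 => /eqP-> ->.
by exists [mset i]; rewrite ?in_fset1 //; exists [mset j]; rewrite ?in_fset1.
Qed.

Lemma holds_summands v phi s : quadratic s ->
  (summands (rename phi s) `<=` v)%fset <-> holds (lin v) (quad v) phi s.
Proof.
elim: s => [i _|s1 IH1 s2 IH2 /= /andP[/IH1 E1 /IH2 E2]|s1 _ s2 _].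
- by rewrite fsub1set.
- by rewrite fsubUset -E1 -E2; split=> [/andP|[-> ->]].
- by case: s1 => // i; case: s2 => // j _; rewrite summands_mul fsub1set.
Qed.

Lemma rule1_closedE H v :
  rule1_closed H v <-> forall f, f \in H -> horn (lin v) (quad v) f.
Proof.
split=> R f.
  move=> fH phi /(holds_summands _ _ (quadratic_rhs f)) h.
  exact/(holds_summands _ _ (quadratic_query f))/R.
move=> phi fH /(holds_summands _ _ (quadratic_rhs f)) h.
by apply/(holds_summands _ _ (quadratic_query f))/R.
Qed.

Lemma quadC v x y : quad v x y -> quad v y x.
Proof. by rewrite /quad msetDC. Qed.

(** * Walks and their parity *)

Section Graph.

Variable v : polynomial.

Lemma edge_sym x y : edge v x y = edge v y x.
Proof. by rewrite /edge eq_sym msetDC. Qed.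

Lemma edge_quad x y : edge v x y -> quad v x y.
Proof. by case/andP. Qed.

Lemma quad_edge x y : ~ basic_zero v -> quad v x y -> edge v x y.
Proof.
move=> nz xy; apply/andP; split=> //; apply/eqP => E; apply: nz; apply: Or31.
by exists x; move: xy; rewrite /quad -E.
Qed.

Lemma walk0 x : walk v 0 x x. Proof. by exists [::]. Qed.

Lemma walk1 x y : edge v x y -> walk v 1 x y.
Proof. by move=> xy; exists [:: y]; rewrite /= xy. Qed.

Lemma walk_cat m n x y z : walk v m x y -> walk v n y z -> walk v (m + n) x z.
Proof.
move=> [s [sp sl <-]] [t [tp tl <-]]; exists (s ++ t).
by rewrite cat_path last_cat size_cat sl sp tp tl.
Qed.

Lemma walk_sym n x y : walk v n x y -> walk v n y x.
Proof.
move=> [s [sp <- <-]]; exists (rev (belast x s)).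
rewrite size_rev size_belast rev_path (eq_path (e' := edge v)); last first.
  by move=> a b; rewrite edge_sym.
by split=> //; case: s {sp} => //= a s; rewrite rev_cons last_rcons.
Qed.

(** Induction on the length: rotated to a repeated vertex, an odd closed walk splits into two
    shorter closed walks, one of which is odd. *)
Lemma odd_cycle_of_cycle c : cycle (edge v) c -> odd (size c) -> odd_cycle v.
Proof.
have [n] := ubnP (size c); elim: n c => // n IH c; rewrite ltnS => cn cc oc.
case: (boolP (uniq c)) => [uc|/(uniqPn 0)[i [j [ij jc E]]]].
  by exists c; split=> //; apply/andP.
have ic := ltn_trans ij jc.
have [y [s1 [s2 rE]]] : exists y s1 s2, rot i c = y :: s1 ++ y :: s2.
  rewrite /rot (drop_nth 0 ic) /=; exists (nth 0 c i).
  have : nth 0 c i \in drop i.+1 c ++ take i c.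
    rewrite mem_cat E; apply/orP; left.
    rewrite -[j](subnKC ij) -nth_drop mem_nth // size_drop.
    by rewrite ltn_sub2r // (leq_ltn_trans _ jc).
  by case/splitPr=> s1 s2; exists s1, s2.
have : cycle (edge v) (rot i c) by rewrite rot_cycle.
move: cn oc; rewrite -(size_rot i c) rE /= size_cat /= addnS /= negbK => cn oc.
rewrite rcons_cat cat_path /= => /andP[p1 /andP[e1 p2]].
have c1 : cycle (edge v) (y :: s1) by rewrite /= rcons_path p1.
case o1: (odd (size s1)); last first.
  by apply: (IH (y :: s1)) => //=; rewrite ?o1 // (leq_trans _ cn) // !ltnS leq_addr.
apply: (IH (y :: s2)) => //=; first by rewrite (leq_trans _ cn) // !ltnS leq_addl.
by move: oc; rewrite oddD o1.
Qed.

Lemma odd_closed_walk n x : odd n -> walk v n x x -> odd_cycle v.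
Proof.
move=> on [s [sp sl sn]]; rewrite -sn in on.
case/lastP: s sp sl on {sn} => // s y; rewrite last_rcons => sp yx.
rewrite yx in sp *; rewrite size_rcons => on.
exact: (@odd_cycle_of_cycle (x :: s)).
Qed.

Lemma walk_parity m n x y : ~ odd_cycle v ->
  walk v m x y -> walk v n x y -> odd m = odd n.
Proof.
move=> nc hm hn; have /(@odd_closed_walk (m + n)) := walk_cat hm (walk_sym hn).
by rewrite oddD; case: (odd m) (odd n) => [] [] // /(_ isT).
Qed.

End Graph.

(** * Monotonicity in the set of summands *)

Section Mono.

Variables (v w : polynomial) (vw : (v `<=` w)%fset).

Lemma edge_mono x y : edge v x y -> edge w x y.
Proof. by case/andP => xy /(fsubsetP vw) h; apply/andP. Qed.

Lemma marked_mono x : marked v x -> marked w x.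
Proof.
by move=> [/(fsubsetP vw) xw [y xy]]; split=> //; exists y; apply: edge_mono.
Qed.

Lemma walk_mono n x y : walk v n x y -> walk w n x y.
Proof.
move=> [s [sp sl sn]]; exists s; split=> //.
by apply: sub_path sp => a b; apply: edge_mono.
Qed.

Lemma opposite_mono x y : opposite_class v x y -> opposite_class w x y.
Proof. by move=> [n [on h]]; exists n; split=> //; apply: walk_mono. Qed.

Lemma same_mono x y : same_class v x y -> same_class w x y.
Proof. by move=> [n [on h]]; exists n; split=> //; apply: walk_mono. Qed.

Lemma has_D_mono : has_D_component v -> has_D_component w.
Proof.
move=> [x [y [mx my xy]]]; exists x, y.
by split; [apply: marked_mono|apply: marked_mono|apply: opposite_mono].
Qed.

Lemma basic_zero_mono : basic_zero v -> basic_zero w.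
Proof.
case=> [[x xx]|[m mv m3]|[c [/andP[cc uc] oc]]].
- by apply: Or31; exists x; apply: (fsubsetP vw).
- by apply: Or32; exists m => //; apply: (fsubsetP vw).
apply: Or33; exists c; split=> //; apply/andP; split=> //.
by case: c cc {uc oc} => //= x c; apply: sub_path => a b; apply: edge_mono.
Qed.

Lemma holds_mono phi s :
  holds (lin v) (quad v) phi s -> holds (lin w) (quad w) phi s.
Proof. by apply: sub_holds => [x|x y]; apply: (fsubsetP vw). Qed.

Lemma within_mono k k' x y : enat_le k k' -> within k v x y -> within k' w x y.
Proof.
case: k' => // k'; case: k => //= k kk' [m mk h]; exists m; last exact: walk_mono.
by rewrite (leq_trans mk) // leq_double.
Qed.

End Mono.

Definition env_closed (v : polynomial) : Prop := forall x y,
  marked v x -> marked v y -> opposite_class v x y -> quad v x y.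

Lemma closedE H p q v : Defs.closed H p q (Sum v) <->
  [/\ ~ basic_zero v, env_closed v,
      forall f, f \in H -> horn (lin v) (quad v) f & rule2_closed p q v].
Proof.
split.
  move=> [E [/rule1_closedE R1 R2]]; split=> //; inversion_clear E.
    by [].
  by move=> x y mx my xy; apply/H1; right; exists x, y.
move=> [nz E /rule1_closedE R1 R2]; split=> //; apply: env_edges => // m.
split; first by left.
by case=> // [[x [y [-> mx my xy]]]]; apply: E.
Qed.

(** For [w] below all members of a nonempty family of closed terms, a rule need only be checked on
    conclusions already present in every member. This serves for intersections and for induction on
    a closure. *)
Lemma closed_meet (K : polynomial -> Prop) H p q w :
  enat_le p q -> (exists v, K v) ->
  (forall v, K v -> Defs.closed H p q (Sum v) /\ (w `<=` v)%fset) ->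
  (forall f phi, f \in H -> holds (lin w) (quad w) phi (rhs f) ->
     (forall v, K v -> holds (lin v) (quad v) phi (query f)) ->
     holds (lin w) (quad w) phi (query f)) ->
  (forall x x' y, marked w x -> marked w x' -> same_class w x x' ->
     edge w x' y -> (forall v, K v -> quad v x y) -> quad w x y) ->
  (forall x y, marked w x -> marked w y -> opposite_class w x y ->
     (forall v, K v -> quad v x y) -> quad w x y) ->
  Defs.closed H p q (Sum w).
Proof.
move=> pq [v0 Kv0] KC C1 C2 C3; apply/closedE.
have nz : ~ basic_zero w.
  move=> zw; have [/closedE[nz _ _ _] wv] := KC _ Kv0.
  exact/nz/(basic_zero_mono wv).
have J k : (forall v, K v -> exists2 k', enat_le k k' & join_closed k' v) ->
    join_closed k w.
  move=> Kk x x' y mx mx' s d e; apply: quad_edge => //.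
  apply: (C2 _ _ _ mx mx' s e) => v Kv; have [k' kk' Jv] := Kk _ Kv.
  have [_ wv] := KC _ Kv; apply/edge_quad/Jv.
  - exact: (marked_mono wv mx).
  - exact: (marked_mono wv mx').
  - exact: (same_mono wv s).
  - exact: (within_mono wv kk' d).
  - exact: (edge_mono wv e).
split=> //.
- move=> x y mx my xy; apply: C3 => // v Kv.
  have [/closedE[_ Ev _ _] wv] := KC _ Kv; apply: Ev.
  - exact: (marked_mono wv mx).
  - exact: (marked_mono wv my).
  - exact: (opposite_mono wv xy).
- move=> f fH phi hr; apply: C1 => // v Kv.
  have [/closedE[_ _ R _] wv] := KC _ Kv.
  by apply: R => //; apply: (holds_mono wv).
have kk k : enat_le k k by case: k => /=.
split=> [nD|D]; apply: J => v Kv; have [/closedE[_ _ _ [Rp Rq]] wv] := KC _ Kv.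
  (* A member may have a D-component although [w] has none; its join rule then has the bound [q],
     which is at least [p]. *)
  by have [/Rq|/Rp] := pselect (has_D_component v); [exists q|exists p].
by exists q => //; apply/Rq/(has_D_mono wv).
Qed.

(** * Closures *)

Definition least_closed H p q (v0 : polynomial) (N : nform) : Prop :=
  [/\ nform_le (Sum v0) N, Defs.closed H p q N &
      forall N', nform_le (Sum v0) N' -> Defs.closed H p q N' -> nform_le N N'].

Lemma env_rule_total v : exists N, env_rule (Sum v) N.
Proof.
have [zv|nz] := pselect (basic_zero v); first by exists Zero; apply: env_basic_zero.
pose S := flatten [seq enum_mset m | m : {mset nat} <- enum_fset v].
pose joins m := exists x y, [/\ m = [mset x; y], marked v x, marked v y
  & opposite_class v x y].
exists (Sum
  (v `|` [fset m in [seq [mset x; y] | x <- S, y <- S] | `[<joins m>]])%fset).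
apply: env_edges => // m; rewrite !inE.
split=> [/orP[|/andP[_ /asboolP]]|[->//|jm]]; [by left|by right|].
apply/orP; right; apply/andP; split; last exact/asboolP.
have mS x : marked v x -> x \in S.
  move=> [xv _]; apply/flatten_mapP.
  by exists [mset x]; rewrite -?enum_msetE ?in_mset1.
by move: jm => [x [y [-> mx my _]]]; apply/allpairsP; exists (x, y); rewrite !mS.
Qed.

Lemma nform_le_trans N' N M : nform_le N N' -> nform_le N' M -> nform_le N M.
Proof. by case: M N N' => [|m] [|n] [|n'] //=; apply: fsubset_trans. Qed.

Lemma env_rule_le v N : env_rule (Sum v) N -> nform_le (Sum v) N.
Proof.
move=> h; inversion_clear h => //=; apply/fsubsetP => m mv.
by apply/H0; left.
Qed.

Lemma env_rule_least H p q v N N' : env_rule (Sum v) N ->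
  nform_le (Sum v) N' -> Defs.closed H p q N' -> nform_le N N'.
Proof.
case: N' => [|w] h vw C; first by case: N h.
case/closedE: C => nz E _ _.
inversion_clear h; first by case: nz; apply: basic_zero_mono vw _.
apply/fsubsetP => m /H1[/(fsubsetP vw) //|[x [y [-> mx my xy]]]].
apply: E; [exact: (marked_mono vw mx)|exact: (marked_mono vw my)|].
exact: (opposite_mono vw xy).
Qed.

(** A closed form above the summands is above their environment normal form by [env_rule_least], so
    the closure can start from the summands themselves. *)
Lemma is_closureE (H : {set ident}) p q t N : i_tau \notin H ->
  is_closure H p q t N <-> least_closed H p q (summands t) N.
Proof.
rewrite /is_closure => /negPf->; split.
  move=> [N0 [hN0 le0 C L]]; split=> //.
    exact: nform_le_trans (env_rule_le hN0) le0.
  by move=> N' le' C'; apply: L => //; apply: (env_rule_least hN0 le' C').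
move=> [le0 C L]; have [N0 hN0] := env_rule_total (summands t).
exists N0; split=> //; first exact: (env_rule_least hN0 le0 C).
by move=> N' le' C'; apply: L => //; apply: nform_le_trans (env_rule_le hN0) le'.
Qed.

(** If no closed sum contains [v0], the closure is [Zero]; otherwise it is the intersection of all
    such sums, finite because it is cut out of one of them. *)
Lemma least_closed_exists H p q v0 : enat_le p q ->
  exists N, least_closed H p q v0 N.
Proof.
move=> pq; pose K v := Defs.closed H p q (Sum v) /\ (v0 `<=` v)%fset.
have [[v1 K1]|nK] := pselect (exists v, K v); last first.
  exists Zero; split=> //; first by split=> //; constructor.
  by case=> // v h C; apply: nK; exists v.
pose w := [fset m in v1 | `[<forall v, K v -> m \in v>]]%fset.
have inw m : m \in w <-> forall v, K v -> m \in v.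
  rewrite !inE /=; split=> [/andP[_ /asboolP] //|h].
  by rewrite h //=; apply/asboolP.
have wv v : K v -> (w `<=` v)%fset.
  by move=> Kv; apply/fsubsetP => m /inw; apply.
have hw phi s : (forall v, K v -> holds (lin v) (quad v) phi s) ->
    holds (lin w) (quad w) phi s.
  elim: s => /= [i h|s1 IH1 s2 IH2 h|s1 _ s2 _ h].
  - exact/inw.
  - by split; [apply: IH1|apply: IH2] => v /h[].
  - case: s1 h => [i|s s'|s s'] h; try by have := h _ K1.
    by case: s2 h => [j|s s'|s s'] h; try by [have := h _ K1|apply/inw].
exists (Sum w); split.
- by apply/fsubsetP => m mv0; apply/inw => v [_ /fsubsetP]; apply.
- apply: (@closed_meet K) => //; first by exists v1.
  + by move=> v Kv; split; [case: Kv|apply: wv].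
  + by move=> f phi _ _; apply: hw.
  + by move=> x x' y _ _ _ _ h; apply/inw.
  + by move=> x y _ _ _ h; apply/inw.
by case=> // v h C; apply: wv.
Qed.

Lemma mset1_inj (x y : nat) : [mset x] = [mset y] -> x = y.
Proof. by move=> E; apply/eqP; rewrite -(in_mset1 y) -E in_mset1. Qed.

Lemma mset1_neq2 (x a b : nat) : [mset x] <> [mset a; b].
Proof.
move=> E; have ax : a = x by apply/eqP; rewrite -(in_mset1 x) E mset21.
have bx : b = x by apply/eqP; rewrite -(in_mset1 x) E mset22.
by move/msetP/(_ x): E; rewrite ax bx msetE2 !msetnxx.
Qed.

Lemma mset2_inj (x y a b : nat) : [mset x; y] = [mset a; b] ->
  x = a /\ y = b \/ x = b /\ y = a.
Proof.
move=> E; have /mset2P[xa|xb] : x \in [mset a; b] by rewrite -E mset21.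
  by left; split=> //; move: E; rewrite xa => /(can_inj (msetDKB _))/mset1_inj.
right; split=> //; move: E; rewrite xb [RHS]msetDC.
by move=> /(can_inj (msetDKB _))/mset1_inj.
Qed.

Lemma summands_holds (L : nat -> Prop) (Q : nat -> nat -> Prop) s (m : {mset nat}) :
  quadratic s -> holds L Q id s -> m \in summands s ->
  (exists2 x, L x & m = [mset x]) \/ exists x y, Q x y /\ m = [mset x; y].
Proof.
elim: s => [i _ iL|s1 IH1 s2 IH2 /= /andP[q1 q2] [h1 h2]|s1 _ s2 _].
- by rewrite in_fset1 => /eqP->; left; exists i.
- by rewrite in_fsetU => /orP[]; [apply: IH1|apply: IH2].
- case: s1 => // i; case: s2 => // j _ ij; rewrite summands_mul in_fset1 => /eqP->.
  by right; exists i, j.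
Qed.

Section Closure.

Variables (H : {set ident}) (p q : enat) (f : ident) (v : polynomial).
Hypothesis tauH : i_tau \notin H.
Hypothesis pq : enat_le p q.
Hypothesis vL : least_closed H p q (summands (rhs f)) (Sum v).

Lemma sub_least : (summands (rhs f) `<=` v)%fset. Proof. by case: vL. Qed.

Lemma least_nz : ~ basic_zero v.
Proof. by case: vL => _ /closedE[]. Qed.

Lemma least_env : env_closed v.
Proof. by case: vL => _ /closedE[]. Qed.

Lemma least_horn g : g \in H -> horn (lin v) (quad v) g.
Proof. by case: vL => _ /closedE[_ _ R _] _; apply: R. Qed.

Lemma rhs_holds : holds (lin v) (quad v) id (rhs f).
Proof.
apply/(holds_summands _ _ (quadratic_rhs f)).
have -> : rename id (rhs f) = rhs f by elim: (rhs f) => //= s -> t ->.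
exact: sub_least.
Qed.

(** Induction along the closure: if the rules preserve [P], the summands satisfying [P] form a
    closed term, which by minimality is everything. *)
Lemma least_ind (P : {mset nat} -> Prop) :
  let w := [fset m in v | `[<P m>]]%fset in
  (forall m, m \in summands (rhs f) -> P m) ->
  (forall g phi, g \in H -> holds (lin w) (quad w) phi (rhs g) ->
     holds (lin v) (quad v) phi (query g) -> holds (lin w) (quad w) phi (query g)) ->
  (forall x x' y, marked w x -> marked w x' -> same_class w x x' ->
     edge w x' y -> quad v x y -> P [mset x; y]) ->
  (forall x y, marked w x -> marked w y -> opposite_class w x y ->
     quad v x y -> P [mset x; y]) ->
  forall m, m \in v -> P m.
Proof.
move=> w P0 C1 C2 C3 m mv; have [_ C L] := vL.
have wv : (w `<=` v)%fset by apply/fsubsetP => n; rewrite !inE => /andP[].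
have inw n : n \in v -> P n -> n \in w.
  by move=> nv Pn; rewrite !inE nv; apply/asboolP.
have /L/(_ _)/fsubsetP/(_ m mv) : nform_le (Sum (summands (rhs f))) (Sum w).
  by apply/fsubsetP => n nf; apply: inw (P0 _ nf); apply: (fsubsetP sub_least).
rewrite !inE mv => h; apply/asboolP/h.
apply: (@closed_meet (eq v)) => //; first by exists v.
- by move=> _ <-.
- by move=> g phi gH hr h'; apply: C1 => //; apply: h'.
- move=> x x' y mx mx' s e h'.
  exact: inw (h' v erefl) (C2 _ _ _ mx mx' s e (h' v erefl)).
- move=> x y mx my o h'.
  exact: inw (h' v erefl) (C3 _ _ mx my o (h' v erefl)).
Qed.

(** The rules create no new variables, since apart from [i_tau] each query uses only variables of
    its right side. *)
Lemma vars_support (m : {mset nat}) x : m \in v -> x \in m -> x \in vars (rhs f).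
Proof.
move=> mv; move: x; move: m mv; set S := vars _.
pose P (m : {mset nat}) := forall x, x \in m -> x \in S.
pose w := [fset m in v | `[<P m>]]%fset.
have inw n : n \in w -> P n by rewrite !inE => /andP[_ /asboolP].
have wS g phi i : holds (lin w) (quad w) phi g -> i \in vars g -> phi i \in S.
  elim: g => /= [j|s1 IH1 s2 IH2 [/IH1 h1 /IH2 h2]|s1 _ s2 _].
  - by move=> /inw h; rewrite inE => /eqP->; apply: h; rewrite in_mset1.
  - by rewrite mem_cat => /orP[].
  - case: s1 => // j; case: s2 => // k /inw h.
    by rewrite !inE => /orP[] /eqP->; apply: h; [apply: mset21|apply: mset22].
have mw x : marked w x -> x \in S.
  by move=> [/inw h _]; apply: h; rewrite in_mset1.
have P2 x y : x \in S -> y \in S -> P [mset x; y].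
  by move=> xS yS z /mset2P[] ->.
apply: (@least_ind P).
- move=> m /(summands_holds (quadratic_rhs f) (L := fun x => x \in S)
    (Q := fun x y => (x \in S) && (y \in S))) [].
  + rewrite /S; elim: (rhs f) (quadratic_rhs f) => /= [i _|s1 IH1 s2 IH2|s1 _ s2 _].
    * exact: mem_head.
    * case/andP=> /IH1 h1 /IH2 h2; split.
        by apply: sub_holds h1 => [x|x y]; rewrite !mem_cat;
          [move=> ->|case/andP=> -> ->].
      by apply: sub_holds h2 => [x|x y]; rewrite !mem_cat;
          [move=> ->|case/andP=> -> ->]; rewrite !orbT.
    * by case: s1 => // i; case: s2 => // j _; rewrite !inE !eqxx ?orbT.
  + by move=> [x xS ->] y; rewrite in_mset1 => /eqP->.
  + by move=> [x [y [/andP[xS yS] ->]]]; apply: P2.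
- move=> g phi gH hr hq.
  have gt : g != i_tau by apply: contraNneq tauH => <-.
  have : {in vars (query g), forall i, phi i \in S}.
    by move=> i /(vars_query gt); apply: wS.
  elim: (query g) hq => /= [i h sV|s1 IH1 s2 IH2 [h1 h2] sV|s1 _ s2 _].
  + rewrite /lin !inE h; apply/asboolP => x; rewrite in_mset1 => /eqP->.
    by apply: sV; rewrite inE.
  + by split; [apply: IH1|apply: IH2] => // i iV; apply: sV; rewrite mem_cat iV ?orbT.
  + case: s1 => // i; case: s2 => // j h sV.
    by rewrite /quad !inE h; apply/asboolP/P2; apply: sV; rewrite !inE eqxx ?orbT.
- move=> x x' y /mw xS _ _ /andP[_ /inw h] _; apply: P2 => //.
  by apply: h; apply: mset22.
- by move=> x y /mw xS /mw yS _ _; apply: P2.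
Qed.

End Closure.

(** * Independence of the distance bounds *)

(* The complete bipartite graphs on t, u, on a, ..., d and on x0, ..., x5, with the
   parity of the variable number as bipartition. *)
Definition block x := if x < 5 then 0 else if x < 9 then 1 else 2.

Definition block_adj x y :=
  [&& block x == block y, odd x != odd y, 2 < x < 15 & 2 < y < 15].

Definition block_horn (K : seq nat) : {set ident} :=
  [set g | `[< horn (fun x => x \in K) block_adj g >]].

(** In a disjoint union of complete bipartite graphs a path of length three always closes up. A
    marked vertex (3 or 10) and the unmarked 2 make the clause of [i_tau] fail, so [m_trivial] holds
    vacuously. *)
Lemma block_horn_closed (K : seq nat) : 3 \in K \/ 10 \in K -> 2 \notin K ->
  rule_closed (block_horn K).
Proof.
move=> K1 K2; apply/allP => r rR; apply/implyP => /allP r1; apply/allP => g gr.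
rewrite inE; apply/asboolP.
apply: (horn_rules _ _ _ _ rR _ gr) => [x y|x|a b c d _ _|triv x y|h hr].
- by rewrite /block_adj eq_sym [odd x == _]eq_sym => /and4P[-> -> -> ->].
- by rewrite /block_adj !eqxx.
- rewrite /block_adj => /and4P[/eqP-> ab -> _] /and4P[/eqP-> bc _ _].
  case/and4P=> [-> cd _ ->].
  by move: ab bc cd; do 4!case: odd.
- by case: K1 K2 => /(triv _ 2) /= -> .
- by have := r1 _ hr; rewrite inE => /asboolP.
Qed.

Lemma derive_block (K : seq nat) gens : 3 \in K \/ 10 \in K -> 2 \notin K ->
  all (ltn^~ 15) K ->
  all (fun g => (g != i_tau) && hornb 15 (fun x => x \in K) block_adj g) gens ->
  {subset derive gens <= block_horn K}.
Proof.
move=> K1 K2 /allP Klt /allP hg; apply: derive_sub; first exact: block_horn_closed.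
move=> g /hg/andP[gt gb]; rewrite inE; apply/asboolP.
apply: hornP gb => // x y /and4P[_ _ /andP[_ ->] /andP[_ ->]] //.
Qed.

(** The derived identities mark nothing beyond [K] in the block graph. Here and in the next two
    lemmas the identities left out are those that enlarge the closure decisively: they add a mark or
    force a square. *)
Lemma block_horn_nu :
  {subset derive [:: i_delta; i_beta; i_eta] <= block_horn [:: 3]}.
Proof. by apply: derive_block; [left| | |vm_compute]. Qed.

Lemma block_horn_iota :
  {subset derive [:: i_delta; i_beta] <= block_horn [:: 10]}.
Proof. by apply: derive_block; [right| | |vm_compute]. Qed.

Lemma block_horn_iota_D :
  {subset derive [:: i_delta; i_lambda] <= block_horn [:: 10; 3; 4]}.
Proof. by apply: derive_block; [right| | |vm_compute]. Qed.

Section Closure.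

Variables (H : {set ident}) (p q : enat) (f : ident) (v : polynomial).
Hypothesis tauH : i_tau \notin H.
Hypothesis pq : enat_le p q.
Hypothesis vL : least_closed H p q (summands (rhs f)) (Sum v).

Let nz : ~ basic_zero v := least_nz vL.
Let env : env_closed v := least_env vL.
Let R g : g \in H -> horn (lin v) (quad v) g := least_horn vL (g := g).
Let v0 : holds (lin v) (quad v) id (rhs f) := rhs_holds vL.

Let nc : ~ odd_cycle v.
Proof. by move=> h; apply: nz; apply: Or33. Qed.

(** If the block graph with marks [K] obeys all clauses of [H], every linear summand of the closure
    stays in [K] and every product inside a block, by [least_ind]. *)
Lemma confined (K : seq nat) :
  holds (fun x => x \in K) block_adj id (rhs f) ->
  {subset H <= block_horn K} -> forall x, lin v x -> x \in K.
Proof.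
move=> P0 HK; pose P m := (exists2 x, x \in K & m = [mset x]) \/
     exists x y, block_adj x y /\ m = [mset x; y].
suff Pv m : m \in v -> P m.
  move=> x /Pv[[y yK /mset1_inj->] //|[a [b [_ /mset1_neq2]]]] //.
move: m; pose w := [fset m in v | `[<P m>]]%fset.
have adjC x y : block_adj x y -> block_adj y x.
  by rewrite /block_adj eq_sym [odd x == _]eq_sym => /and4P[-> -> -> ->].
have linK x : lin w x -> x \in K.
  rewrite /lin !inE => /andP[_ /asboolP[[y yK /mset1_inj->] //|]].
  by case=> a [b [_ /mset1_neq2]].
have quadB x y : quad w x y -> block_adj x y.
  rewrite /quad !inE => /andP[_ /asboolP[[z _ /esym /mset1_neq2] //|]].
  by case=> a [b [ab /mset2_inj[[-> ->]|[-> ->]]]] //; apply: adjC.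
have holdsB phi s : holds (lin w) (quad w) phi s ->
    holds (fun x => x \in K) block_adj phi s.
  exact: sub_holds linK quadB.
have Bholds phi s : holds (lin v) (quad v) phi s ->
    holds (fun x => x \in K) block_adj phi s ->
    holds (lin w) (quad w) phi s.
  elim: s => /= [i h1 h2|s1 IH1 s2 IH2 [h1 h2] [h3 h4]|s1 _ s2 _].
  - by rewrite /lin !inE h1; apply/asboolP; left; exists (phi i).
  - by split; [apply: IH1|apply: IH2].
  - case: s1 => // i; case: s2 => // j h1 h2; rewrite /quad !inE h1.
    by apply/asboolP; right; exists (phi i), (phi j).
have walkB n x y : walk w n x y -> block x = block y /\ odd y = odd x (+) odd n.
  move=> [s [sp <- <-]] {n}; elim: s x sp => [|z s IH] x /=; first by rewrite addbF.
  case/andP=> /edge_quad/quadB/and4P[/eqP-> xz _ _] /IH[-> ->]; split=> //.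
  by move: xz; rewrite /=; case: (odd x); case: (odd z); case: (odd (size s)).
have markB x : marked w x -> 2 < x < 15.
  by move=> [_ [y /edge_quad/quadB/and4P[]]].
apply: (least_ind pq vL (P := P)).
- by move=> m; apply: summands_holds P0; apply: quadratic_rhs.
- move=> g phi gH hr hq; apply: Bholds => //.
  by have := HK _ gH; rewrite inE => /asboolP/(_ phi (holdsB _ _ hr)).
- move=> x x' y /markB mx _ [n [en /walkB[xb xo]]] /edge_quad/quadB B _.
  right; exists x, y; split=> //; move: B => /and4P[B1 B2 _ B4].
  rewrite /block_adj xb B1 mx B4 !andbT /=.
  by move: B2; rewrite xo (negPf en) addbF.
- move=> x y /markB mx /markB my [n [on /walkB[xb xo]]] _.
  right; exists x, y; split=> //.
  by rewrite /block_adj xb eqxx mx my xo on; case: (odd x).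
Qed.

(** The pairs not reached by the join rule at distance two. Excluding them makes all positive bounds
    equivalent. *)
Definition far x x' := [/\ marked v x, marked v x', same_class v x x', x <> x' &
  forall y, edge v x y -> edge v x' y -> False].

Lemma far_sym x x' : far x x' -> far x' x.
Proof.
move=> [mx mx' [n [en h]] xx' c]; split=> //; [|by move=> E; apply: xx'|].
  by exists n; split=> //; apply: walk_sym.
by move=> y hx' hx; apply: (c y).
Qed.

(** The environment rule would join [o] to both vertices, giving a common neighbour. *)
Lemma far_opposite x x' o : far x x' -> marked v o -> opposite_class v x o -> False.
Proof.
move=> [mx mx' [n [en h]] _ c] mo [k [ok ho]].
apply: (c o); apply: quad_edge => //; apply: env => //; first by exists k.
exists (n + k); split; first by rewrite oddD (negPf en).
exact: walk_cat (walk_sym h) ho.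
Qed.

(** One end of an edge with both ends marked is in the class opposite to [x]. *)
Lemma far_marked_edge x x' o1 o2 n : far x x' -> walk v n x o1 ->
  lin v o1 -> lin v o2 -> quad v o1 o2 -> False.
Proof.
move=> F h m1 m2 /(quad_edge nz) e.
have M1 : marked v o1 by split=> //; exists o2.
have M2 : marked v o2 by split=> //; exists o1; rewrite edge_sym.
case on: (odd n); first by apply: (far_opposite F M1); exists n.
apply: (far_opposite F M2); exists (n + 1); split; first by rewrite addn1 /= on.
exact: walk_cat h (walk1 e).
Qed.

Lemma far_path x x' : far x x' -> exists s : seq nat,
  [/\ uniq (x :: s), 4 <= size s &
      forall z, z \in x :: s -> z \in vars (rhs f) /\ exists n, walk v n x z].
Proof.
move=> [mx mx' [n [en [s0 [sp sl sn]]]] xx' c].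
have hn : walk v n x x' by exists s0.
case/shortenP: sp sl sn => s sp us _ sl _.
have hs : walk v (size s) x x' by exists s.
have es : odd (size s) = false by rewrite (walk_parity nc hs hn) (negPf en).
have vS y z : edge v y z -> z \in vars (rhs f).
  by move/edge_quad => yz; exact: (vars_support tauH pq vL yz (mset22 _ _)).
have pS t y : path (edge v) y t -> {subset t <= vars (rhs f)}.
  elim: t y => //= z t IH y /andP[yz /IH h] i.
  by rewrite inE => /orP[/eqP->|/h //]; apply: vS yz.
exists s; split=> //; last first.
  move=> z zs; split; last first.
    case/splitPl: zs sp => s1 s2 lz; rewrite cat_path => /andP[p1 _].
    by exists (size s1), s1.
  move: zs; rewrite inE => /orP[/eqP->|/(pS _ _ sp) //].
  by case: mx => xv _; apply: (vars_support tauH pq vL xv); rewrite in_mset1.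
case: s sp sl es us {hs} => [|y [|z [|t [|]]]] //=.
by move=> /andP[xy /andP[yz _]] zx' _ _; case: (c y) => //; rewrite edge_sym -zx'.
Qed.

Lemma far_size (S : seq nat) x x' : far x x' ->
  (forall z n, walk v n x z -> z \in vars (rhs f) -> z \in S) -> 4 < size S.
Proof.
move=> /far_path[s [us s4 sP]] h.
apply: leq_trans (uniq_leq_size us _); first exact: s4.
by move=> z /sP[zV [n hn]]; apply: h hn zV.
Qed.

(** The component of a far pair avoids [t] and [u], so its five or more vertices are among the other
    variables. *)
Lemma far_D x x' : lin v 3 -> lin v 4 -> quad v 3 4 -> far x x' ->
  4 < size [seq z <- undup (vars (rhs f)) | z \notin [:: 3; 4]].
Proof.
move=> m3 m4 e34 F; apply: (far_size F) => z n hn zV.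
rewrite mem_filter mem_undup zV andbT !inE; apply/norP; split.
  by apply/eqP => E; apply: (far_marked_edge F _ m3 m4 e34); rewrite -E; apply: hn.
apply/eqP => E; apply: (far_marked_edge F _ m4 m3 (quadC e34)).
by rewrite -E; apply: hn.
Qed.

Lemma no_square x : quad v x x -> False.
Proof. by move/(quad_edge nz); rewrite /edge eqxx. Qed.

(** If [u] gets marked, [t u] is a marked edge and only the four vertices [a], [b], [c], [d] remain.
    Otherwise [H] avoids every identity marking [u] or squaring [t], and [t] is the only marked
    vertex. *)
Lemma no_far_nu x x' : f = i_nu -> far x x' -> False.
Proof.
move=> fE F; have [[m3 e34] [[e56 e67] e78]] :
    (lin v 3 /\ quad v 3 4) /\ (quad v 5 6 /\ quad v 6 7) /\ quad v 7 8.
  by move: v0; rewrite fE.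
have [m4|m4] := pselect (lin v 4).
  by have := far_D m3 m4 e34 F; rewrite fE.
have HK : {subset H <= block_horn [:: 3]}.
  move=> g gH; have gR := R gH.
  apply: block_horn_nu.
  case: g gR gH => gR gH; try by vm_compute.
  - by case: m4; apply: (gR (nth 0 [:: 4; 3])); apply: quadC.
  - by case: m4; apply: (gR (nth 0 [:: 3; 4])).
  - by case: m4; apply: (gR (nth 0 [:: 3; 4; 4; 3])); split=> //; apply: quadC.
  - by case: (@no_square 3); apply: (gR (nth 0 [:: 3; 4])).
  - by case: (@no_square 3); apply: (gR (nth 0 [:: 3; 4])).
  - by move: tauH; rewrite gH.
have only3 y : lin v y -> y = 3.
  have h0 : holds (fun x => x \in [:: 3]) block_adj id (rhs f) by rewrite fE.
  by move=> /(confined h0 HK); rewrite inE => /eqP.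
by case: F => [[/only3 -> _] [/only3 -> _] _ []].
Qed.

(** A far pair lies on the path and in the class of the marked [x1], that is among [x1], [x3], [x5].
    Either [x3] and [x5] are both marked and [x4] becomes a common neighbour, or among these three
    only [x1] is ever marked. *)
Lemma no_far_iota x x' : join_closed (Some 1) v ->
  f = i_iota_2 \/ f = i_iota_2_D -> far x x' -> False.
Proof.
move=> J fE F.
have [m1 [e01 [e12 [e23 [e34 e45]]]]] : lin v 10 /\ quad v 9 10 /\ quad v 10 11 /\
    quad v 11 12 /\ quad v 12 13 /\ quad v 13 14.
  by case: fE v0 => -> /=; tauto.
have zV z n : walk v n x z -> z \in vars (rhs f) -> z \in [:: 9; 10; 11; 12; 13; 14].
  case: (fE) => E hn.
    by rewrite E; move: z {hn}; apply/allP.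
  have [m3 m4 e] : [/\ lin v 3, lin v 4 & quad v 3 4].
    by move: v0; rewrite E /= => -[_ [[]]].
  have z3 : z != 3.
    apply/eqP => z3; apply: (far_marked_edge F _ m3 m4 e).
    by rewrite -z3; exact: hn.
  have z4 : z != 4.
    apply/eqP => z4; apply: (far_marked_edge F _ m4 m3 (quadC e)).
    by rewrite -z4; exact: hn.
  move: z z3 z4 {hn}; rewrite E.
  suff : all (fun z => (z != 3) ==> (z != 4) ==> (z \in [:: 9; 10; 11; 12; 13; 14]))
     (vars (rhs i_iota_2_D)) by move=> /allP h z z3 z4 /h; rewrite z3 z4.
  by [].
have W z : z \in [:: 9; 10; 11; 12; 13; 14] ->
    exists2 n, odd n = odd z & walk v n z 10.
  have w01 := walk1 (quad_edge nz e01).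
  have w12 := walk_sym (walk1 (quad_edge nz e12)).
  have w23 := walk_cat (walk_sym (walk1 (quad_edge nz e23))) w12.
  have w34 := walk_cat (walk_sym (walk1 (quad_edge nz e34))) w23.
  have w45 := walk_cat (walk_sym (walk1 (quad_edge nz e45))) w34.
  rewrite !inE => /or4P[/eqP->|/eqP->|/eqP->|/or3P[/eqP->|/eqP->|/eqP->]].
  - by exists 1.
  - by exists 0 => //; apply: walk0.
  - by exists 1.
  - by exists 2.
  - by exists 3.
  - by exists 4.
have S y y' : far y y' -> y \in [:: 9; 10; 11; 12; 13; 14] -> y \in [:: 10; 12; 14].
  move=> Fy yS; have [n ny hn] := W _ yS.
  have M1 : marked v 10 by split=> //; exists 11; apply: quad_edge.
  have: odd y = false.
    by apply/negP => oy; apply: (far_opposite Fy M1); exists n; rewrite ny.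
  by move: yS; rewrite !inE; do ![case: eqP => [->//|_]].
have [[mx _] [mx' _] [n [_ hn]] xx' c] := F.
have lV y : lin v y -> y \in vars (rhs f).
  by move=> yv; apply: (vars_support tauH pq vL yv); rewrite in_mset1.
have xI := zV x 0 (walk0 _ _) (lV _ mx).
have xS := S _ _ F xI.
have x'S := S _ _ (far_sym F) (zV x' n hn (lV _ mx')).
have m11 : ~ lin v 11.
  by move=> m11; have [k _ hk] := W x xI; apply: (far_marked_edge F hk m1 m11 e12).
have [[m12 m14]|m1214] := pselect (lin v 12 /\ lin v 14).
  (* The join rule at distance two transfers the neighbour [x4] of [x3] to [x1]. *)
  have E y : y \in [:: 10; 12; 14] -> edge v y 13.
    have h34 := quad_edge nz e34.
    rewrite !inE => /orP[/eqP->|/orP[]/eqP-> //]; last first.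
      by rewrite edge_sym; apply: quad_edge.
    have h12 := walk1 (quad_edge nz e12); have h23 := walk1 (quad_edge nz e23).
    apply: (J 10 12 13) => //.
    - by split=> //; exists 11; apply: quad_edge.
    - by split=> //; exists 13.
    - by exists 2; split=> //; apply: (walk_cat h12 h23).
    - by exists 2 => //; apply: (walk_cat h12 h23).
  by apply: (c 13); apply: E.
case: fE => E.
  (* Any identity not derivable from the two generators would mark [x2], mark both [x3] and [x5], or
     produce the square of [x1]. *)
  have HK : {subset H <= block_horn [:: 10]}.
    move=> g gH; have gR := R gH; apply: block_horn_iota.
    case: g gR gH => gR gH; try by vm_compute.
    - by case: m11; apply: (gR (nth 0 [:: 11; 10])); apply: quadC.
    - case: m1214.
      have m12 : lin v 12 by apply: (gR (nth 0 [:: 10; 11; 12])).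
      by split=> //; apply: (gR (nth 0 [:: 12; 13; 14])).
    - by case: m11; apply: (gR (nth 0 [:: 10; 11])).
    - by case: m11; apply: (gR (nth 0 [:: 10; 11; 11; 10])); split=> //; apply: quadC.
    - by case: (@no_square 10); apply: (gR (nth 0 [:: 10; 11])).
    - by case: (@no_square 10); apply: (gR (nth 0 [:: 10; 11])).
    - by move: tauH; rewrite gH.
  have h0 : holds (fun x => x \in [:: 10]) block_adj id (rhs f) by rewrite E.
  have only y : lin v y -> y = 10 by move=> /(confined h0 HK); rewrite inE => /eqP.
  by apply: xx'; rewrite (only _ mx) (only _ mx').
have [m3 m4 e] : [/\ lin v 3, lin v 4 & quad v 3 4].
  by move: v0; rewrite E /= => -[_ [[]]].
(* The marked edge [t u] makes more identities applicable: [i_xi] and [i_beta] now yield the square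
   of [t], and the variants with [D t u] of the marking identities apply too. *)
have HK : {subset H <= block_horn [:: 10; 3; 4]}.
  move=> g gH; have gR := R gH; apply: block_horn_iota_D.
  case: g gR gH => gR gH; try by vm_compute.
  - by case: m11; apply: (gR (nth 0 [:: 11; 10])); apply: quadC.
  - case: m1214.
    have m12 : lin v 12 by apply: (gR (nth 0 [:: 10; 11; 12])).
    by split=> //; apply: (gR (nth 0 [:: 12; 13; 14])).
  - by case: m11; apply: (gR (nth 0 [:: 10; 11])).
  - by case: m11; apply: (gR (nth 0 [:: 10; 11; 11; 10])); split=> //; apply: quadC.
  - case: m1214.
    have m12 : lin v 12 by apply: (gR (nth 0 [:: 10; 11; 12; 3; 4])).
    by split=> //; apply: (gR (nth 0 [:: 12; 13; 14; 3; 4])).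
  - by case: m11; apply: (gR (nth 0 [:: 10; 11; 0; 3; 4])).
  - case: m11; apply: (gR (nth 0 [:: 3; 4; 11; 10])); split=> //; exact: quadC.
  - by case: (@no_square 3); apply: (gR (nth 0 [:: 3; 4])).
  - case: (@no_square 3); apply: (gR (nth 0 [:: 3; 4; 3; 4])); do 2!split=> //.
    exact: quadC.
  - by case: (@no_square 10); apply: (gR (nth 0 [:: 10; 11])).
  - by case: (@no_square 10); apply: (gR (nth 0 [:: 10; 11])).
  - by move: tauH; rewrite gH.
have h0 : holds (fun x => x \in [:: 10; 3; 4]) block_adj id (rhs f) by rewrite E.
have only y : lin v y -> y \in [:: 10; 12; 14] -> y = 10.
  move=> /(confined h0 HK); rewrite !inE => /or3P[]/eqP-> //.
by apply: xx'; rewrite (only x mx xS) (only x' mx' x'S).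
Qed.

(** Every other right side has at most four variables, or at most four besides the [t], [u] of a
    summand [D t u]; both are too few for a path on five vertices. *)
Lemma no_far x x' : join_closed (Some 1) v -> far x x' -> False.
Proof.
move=> J F.
have [|fS] := boolP (f \in [:: i_nu; i_iota_2; i_iota_2_D]).
  rewrite !inE => /or3P[]/eqP fE; first exact: no_far_nu fE F.
    by apply: (no_far_iota J _ F); left.
  by apply: (no_far_iota J _ F); right.
have [small|[D small]] : size (undup (vars (rhs f))) <= 4 \/
    (holds (lin v) (quad v) id (rhs f) -> (lin v 3 /\ lin v 4) /\ quad v 3 4) /\
    size [seq z <- undup (vars (rhs f)) | z \notin [:: 3; 4]] <= 4.
- by case: (f) fS => // _; (by left) || (right; split=> //=; tauto).
- have : 4 < size (undup (vars (rhs f))).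
    by apply: (far_size F) => z n _; rewrite mem_undup.
  by rewrite ltnNge small.
have [[m3 m4] e] := D v0.
by have := far_D m3 m4 e F; rewrite ltnNge small.
Qed.

Lemma join_closed_any k : join_closed (Some 1) v -> join_closed k v.
Proof.
move=> J x x' y mx mx' s _ e.
have [->//|xx'] := eqVneq x x'.
have [[z [zx zx']]|nz'] := pselect (exists z, edge v x z /\ edge v x' z).
  apply: (J x x' y) => //; exists 2 => //.
  by apply: (walk_cat (walk1 zx) (walk1 _)); rewrite edge_sym.
case: (no_far J (x := x) (x' := x')); split=> //; first exact/eqP.
by move=> z zx zx'; apply: nz'; exists z.
Qed.

(** Bound 0 relates a vertex only to itself and is harmless; a positive bound contains the bound 1,
    from which [join_closed_any] gives all others. *)
Lemma join_closed_positive k k' : (k = Some 0 <-> k' = Some 0) ->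
  join_closed k v -> join_closed k' v.
Proof.
move=> kk' Jk; have [k'0|k'n0] := eqVneq k' (Some 0).
  move=> x x' y mx mx' s; rewrite k'0 => -[m].
  by rewrite double0 leqn0 => /eqP-> [t [_ <- /size0nil->]].
apply: join_closed_any => x x' y mx mx' s d; apply: Jk => //.
case: k kk' => // -[[/(_ erefl) k'0]|n _]; first by rewrite k'0 in k'n0.
by case: d => m m2 h; exists m => //; rewrite (leq_trans m2) // leq_double.
Qed.

End Closure.

Lemma least_closed_transfer (H : {set ident}) p q p' q' f N :
  i_tau \notin H -> enat_le p q ->
  (p = Some 0 <-> p' = Some 0) -> (q = Some 0 <-> q' = Some 0) ->
  least_closed H p q (summands (rhs f)) N -> Defs.closed H p' q' N.
Proof.
move=> tauH pq pp' qq'; case: N => [|v] vL; first by split=> //; constructor.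
have [_ /closedE[nz E R [Rp Rq]] _] := vL.
apply/closedE; split=> //; split=> D.
  exact: (@join_closed_positive H p q f v tauH pq vL p p' pp' (Rp D)).
exact: (@join_closed_positive H p q f v tauH pq vL q q' qq' (Rq D)).
Qed.

Theorem lemma7p3 :
  (forall (E : {set ident}) (f : ident),
     entails E f <-> f \in rule_closure E) /\
  (forall (f : ident) (H : {set ident}) (p q p' q' : enat),
     H \subset F25 ->
     enat_le p q -> enat_le p' q' ->
     (p = Some 0 <-> p' = Some 0) ->
     (q = Some 0 <-> q' = Some 0) ->
     exists N : nform,
       is_closure H p q (rhs f) N /\ is_closure H p' q' (rhs f) N).
Proof.
split=> [E f|f H p q p' q' _ pq pq' pp' qq'].
  by split; [apply: entails_rule_closure|apply: rule_closure_entails].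
have [tauH|tauH] := boolP (i_tau \in H).
  by exists Zero; rewrite /is_closure tauH.
have [N L] := least_closed_exists H (summands (rhs f)) pq.
have [N' L'] := least_closed_exists H (summands (rhs f)) pq'.
exists N; rewrite !is_closureE //; split=> //.
(* Each closure is closed for the other pair of bounds, so each is below the other by minimality. *)
have C := least_closed_transfer tauH pq pp' qq' L.
have C' := least_closed_transfer tauH pq' (iff_sym pp') (iff_sym qq') L'.
case: L L' => [le0 _ min] [le0' _ min']; split=> // M leM CM.
exact: nform_le_trans (min _ le0' C') (min' _ leM CM).
Qed.
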